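(* Let $F_n\in\boldsymbol{D}_S$, $n\in\mathbb{N}$. Let $X_n$ be the set of all points of growth of $F_n$, and let $\gamma_n$, $(\lambda_{n,u})$ be the parameters of the spectral representation of the characteristic function of $F_n$ (as specified in the context), with $\lambda_{n,u}=0$ for $u\notin\langle X_n\rangle$. Let $\mathcal{U}=\bigcup_{n=1}^\infty\langle X_n\rangle=\{u_0,u_1,u_2,\ldots\}$ be enumerated with $u_0=0$. Then $(F_n)_{n\in\mathbb{N}}$ is $\boldsymbol{D}_S$-relatively compact in variation if and only if all of the following conditions hold: (i) the numbers $\gamma_n$, $n\in\mathbb{N}$, take only a finite number of values from $\mathcal{U}$; (ii) $\displaystyle\sup_{n\in\mathbb{N}}\sum_{u\in\langle X_n\rangle\setminus\{0\}}|\lambda_{n,u}|<\infty$; (iii) $\displaystyle\lim_{N\to\infty}\sup_{n\in\mathbb{N}}\sum_{u_k\in\mathcal{U}\setminus\{0\}:\ k>N}|\lambda_{n,u_k}|=0$.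
   Context: A discrete distribution function is a function $F(x)=\sum_{k=1}^\infty p_{x_k}I_{x_k}(x)$, $x\in\mathbb{R}$, with distinct real $x_k$, $p_{x_k}\geqslant0$, $\sum_{k=1}^\infty p_{x_k}=1$, where $I_c(x)=1$ if $x\geqslant c$ and $I_c(x)=0$ if $x<c$; its set of points of growth is $X=\{x_k: p_{x_k}>0\}$. $\boldsymbol{D}_S$ is the class of all discrete distribution functions $F$ whose characteristic function $f(t)=\int_{\mathbb{R}}e^{itx}\,dF(x)$ is separated from zero, i.e. there exists $\mu>0$ such that $|f(t)|\geqslant\mu$ for all $t\in\mathbb{R}$. For $Y\subset\mathbb{R}$, $\langle Y\rangle=\bigl\{\sum_{k=1}^m c_ky_k: c_k\in\mathbb{Z},\ y_k\in Y,\ m\in\mathbb{N}\bigr\}$. Sums over the empty set equal zero. The set $\mathcal{U}$ is countable and contains $0$; the $u_k$ in its enumeration are distinct. Spectral representation: for every $F_n\in\boldsymbol{D}_S$ with set of points of growth $X_n$, the characteristic function has a representation $$f_n(t)=\exp\Bigl\{it\gamma_n+\sum_{u\in\langle X_n\rangle\setminus\{0\}}\lambda_{n,u}(e^{itu}-1)\Bigr\},\quad t\in\mathbb{R},$$ with $\gamma_n\in\langle X_n\rangle$, $\lambda_{n,u}\in\mathbb{R}$, $\sum_{u\in\langle X_n\rangle\setminus\{0\}}|\lambda_{n,u}|<\infty$, and the parameters $\gamma_n$ and $\lambda_{n,u}$, $u\in\langle X_n\rangle\setminus\{0\}$, are uniquely determined by $f_n$. A sequence of distribution functions $(F_n)$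 converges in variation to a distribution function $F$ if $\|F_n-F\|\to0$ as $n\to\infty$, where $\|\cdot\|$ denotes the total variation on $\mathbb{R}$. The sequence $(F_n)_{n\in\mathbb{N}}$ is called $\boldsymbol{D}_S$-relatively compact in variation if every subsequence of it contains a further subsequence converging in variation to a distribution function from $\boldsymbol{D}_S$. *)

(* Defs.v *)
From mathcomp Require Export all_boot all_order all_algebra.
From mathcomp Require Export all_classical all_reals all_analysis.
From mathcomp Require Export complex.

Set Implicit Arguments.
Unset Strict Implicit.
Unset Printing Implicit Defensive.

Import Order.TTheory GRing.Theory Num.Theory.
Import numFieldNormedType.Exports.

Local Open Scope classical_set_scope.
Local Open Scope ring_scope.
Local Open Scope complex_scope.

(* Distribution functions on the line: nondecreasing, right-continuous, with
   limits 0 and 1 at -oo and +oo. *)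
Notation distr_fun R := (cumulativeBounded (0 : R) (1 : R)).

Section Complex.
Context {R : realType}.

Definition cexp (z : R[i]) : R[i] :=
  (expR (complex.Re z))%:C * (cos (complex.Im z) +i* sin (complex.Im z)).

Definition cintegral d (T : measurableType d) (mu : {measure set T -> \bar R})
    (f : T -> R[i]) : R[i] :=
  (\int[mu]_(x in setT) complex.Re (f x))
    +i* (\int[mu]_(x in setT) complex.Im (f x)).

(* Unordered sum over D of a real family; it has the expected value when the
   family is absolutely summable on D (an empty sum is 0). *)
Definition rsum (T : choiceType) (D : set T) (f : T -> R) : R :=
  fine (\esum_(x in D) (f^\+ x)%:E) - fine (\esum_(x in D) (f^\- x)%:E).

Definition csum (T : choiceType) (D : set T) (f : T -> R[i]) : R[i] :=
  rsum D (fun x => complex.Re (f x)) +i* rsum D (fun x => complex.Im (f x)).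

End Complex.

Section Defs.
Context {R : realType}.
Implicit Types (F : distr_fun R) (x p : nat -> R) (Y : set R).

(* F = \sum_k p_k I_(x_k); the weights p_k may vanish, so that finitely many
   atoms are allowed. *)
Definition discrete_repr F x p : Prop :=
  [/\ injective x,
      forall k, 0 <= p k,
      series p @ \oo --> (1 : R) &
      forall y, series (fun k => p k * (x k <= y)%R%:R) @ \oo --> (F y : R)].

(* The representation of F is unique up to reordering and atoms of weight 0,
   so the set does not depend on its choice. *)
Definition growth_points F : set R :=
  [set y | exists x p, discrete_repr F x p /\ exists k, x k = y /\ 0 < p k].

Definition char_fun F (t : R) : R[i] :=
  cintegral (lebesgue_stieltjes_measure F) (fun y => cexp (0 +i* (t * y))).

Definition D_S : set (distr_fun R) :=
  [set F | (exists x p, discrete_repr F x p) /\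
           exists2 mu : R, 0 < mu & forall t, mu%:C <= `|char_fun F t|].

Definition zspan Y : set R :=
  [set v | exists (m : nat) (c : 'I_m.+1 -> int) (y : 'I_m.+1 -> R),
     (forall k, Y (y k)) /\ v = \sum_(k < m.+1) y k *~ c k].

Definition spectral_parameters F (gamma : R) (lambda : R -> R) : Prop :=
  let S := zspan (growth_points F) in
  [/\ S gamma,
      summable (S `\ 0) (fun v => (lambda v)%:E) &
      forall t, char_fun F t =
        cexp ((0 +i* (t * gamma)) +
              csum (S `\ 0)
                (fun v => (lambda v)%:C * (cexp (0 +i* (t * v)) - 1)))].

Definition total_variationR (f : R -> R) : \bar R :=
  ereal_sup [set total_variation I.1 I.2 f | I in [set I : R * R | I.1 <= I.2]].

Definition cvg_in_variation (F : nat -> distr_fun R) (G : distr_fun R) : Prop :=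
  total_variationR (fun y => F n y - G y) @[n --> \oo] --> 0%E.

Definition D_S_relatively_compact (F : nat -> distr_fun R) : Prop :=
  forall phi : nat -> nat, increasing_seq phi ->
  exists2 psi : nat -> nat, increasing_seq psi &
  exists2 G, D_S G & cvg_in_variation (fun n => F (phi (psi n))) G.

(* u_0, u_1, ... is a repetition-free enumeration of A; the index set K is all
   of nat when A is infinite, and an initial segment of nat when A is finite. *)
Definition enumerates (K : set nat) (u : nat -> R) (A : set R) : Prop :=
  [/\ forall i j, (i <= j)%N -> K j -> K i,
      set_inj K u &
      u @` K = A].

End Defs.

(* Main.v *)
(* Let A be the Banach algebra of absolutely convergent trigonometric sums
   f(t) = \sum_x a(x) e^{itx}, normed by the l^1-norm of the coefficients a,
   which f determines. Up to a factor 2, the variation distance of two discrete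
   distribution functions is the distance in A of their characteristic
   functions.

   Necessity. If f_n -> f in A and |f| >= mu > 0, then 1/f is in A by Wiener's
   lemma: since |1 - |f|^2| <= 1 - mu^2 < 1, the powers of 1 - |f|^2 decay
   geometrically in A. Hence f_n / f -> 1 in A, so f_n / f has a logarithm of
   small norm in A. Comparing it with the exponents of f_n and f_m, which are
   determined by their exponentials, gives gamma_n = gamma_m and lambda_n close
   to lambda_m in l^1 for large n, m. A sequence violating (i), (ii) or (iii) has
   a subsequence without any further subsequence of this kind.

   Sufficiency. Under (i)-(iii) a diagonal extraction makes gamma_n constant and
   (lambda_n) Cauchy in l^1, so that the f_n are Cauchy in A; their limit is the
   characteristic function of a discrete law, and it is bounded below by
   exp(-2 sup_n |lambda_n|). *)

From HB Require Import structures.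
Require Import Defs.
From mathcomp Require Import ring lra zify measurable_realfun.
Set Implicit Arguments.
Unset Strict Implicit.
Unset Printing Implicit Defensive.
Import Order.TTheory GRing.Theory Num.Theory.
Import numFieldNormedType.Exports.
Import ComplexField.Normc.
Local Open Scope classical_set_scope.
Local Open Scope ring_scope.

(** * Unordered sums *)

(** Only the supremum of [1 - |f|^2] is controlled, and its norm in A may exceed 1. The gap is
    closed by counting: powers of a trigonometric polynomial have polynomially many frequencies, and
    each coefficient is bounded by the supremum. The second obstacle is that an exponential
    determines its exponent only modulo multiples of 2 pi i. Exponents vanish at [t = 0] and the
    relevant differences are uniformly continuous, which fixes the branch. Subtracting the logarithm
    from the difference of two exponents leaves [i t (gamma_n - gamma_m)] plus a bounded term; since
    this vanishes identically, the slope is 0 and the coefficients agree away from the frequency 0.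
    The constant [- \sum lambda] in an exponent affects the frequency 0 only, where [lambda] is set
    to 0. Norms in A are carried by a relation giving an upper bound rather than a value, and
    coefficients are functions on the whole line, so that families with different frequency sets add
    without reindexing. *)

Section Sums.
Context {R : realType}.

(* The sums are locked: unification would otherwise unfold them. *)
Fact lock_key : unit. Proof. by []. Qed.

Definition usum (T : choiceType) (f : T -> R) : R :=
  locked_with lock_key (rsum setT f).

Definition l1 (T : choiceType) (f : T -> R) : \bar R :=
  locked_with lock_key (\esum_(x in setT) `|f x|%:E)%E.
Arguments l1 {T} f%R.

Lemma usum_rsum (T : choiceType) (f : T -> R) : usum f = rsum setT f.
Proof. by rewrite /usum unlock. Qed.

Lemma l1E (T : choiceType) (f : T -> R) :
  l1 f = (\esum_(x in setT) `|f x|%:E)%E.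
Proof. by rewrite /l1 unlock. Qed.

Lemma l1_ge0 (T : choiceType) (f : T -> R) : (0 <= l1 f)%E.
Proof. by rewrite l1E; apply: esum_ge0 => x _; rewrite lee_fin. Qed.

Lemma le_l1 (T : choiceType) (f g : T -> R) :
  (forall x, `|f x| <= `|g x|) -> (l1 f <= l1 g)%E.
Proof. by move=> fg; rewrite !l1E; apply: le_esum => x _; rewrite lee_fin. Qed.

Lemma l1D (T : choiceType) (f g : T -> R) :
  (l1 (fun x => f x + g x)%R <= l1 f + l1 g)%E.
Proof.
rewrite !l1E -esumD//; apply: le_esum => x _.
by rewrite -EFinD lee_fin ler_normD.
Qed.

Lemma l1D_fin (T : choiceType) (f g : T -> R) : (l1 f < +oo)%E ->
  (l1 g < +oo)%E -> (l1 (fun x => f x + g x)%R < +oo)%E.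
Proof.
by move=> sf sg; apply: le_lt_trans (l1D f g) _; apply: lte_add_pinfty.
Qed.

Lemma l1N (T : choiceType) (f : T -> R) : l1 (fun x => - f x)%R = l1 f.
Proof. by rewrite !l1E; apply: eq_esum => x _; rewrite normrN. Qed.

(** One inequality holds for every finite partial sum; the other is the same inequality for [c^-1],
    with [c = 0] treated apart. *)
Lemma esumZ (T : choiceType) (c : R) (f : T -> \bar R) : 0 <= c ->
  (forall x, 0 <= f x)%E ->
  (\esum_(x in setT) (c%:E * f x) = c%:E * \esum_(x in setT) f x)%E.
Proof.
move=> c0 f0.
have H d (g : T -> \bar R) : 0 <= d -> (forall x, 0 <= g x)%E ->
   (\esum_(x in setT) (d%:E * g x) <= d%:E * \esum_(x in setT) g x)%E.
  move=> d0 g0; apply: ge_ereal_sup => _ [X [finX _] <-].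
  rewrite -ge0_mule_fsumr//; apply: lee_wpmul2l; first by rewrite lee_fin.
  by apply: ereal_sup_ubound; exists X.
apply/eqP; rewrite eq_le H//=.
have [->|c1] := eqVneq c 0.
  by rewrite mul0e esum_ge0// => x _; rewrite mul0e.
have {}c0 : 0 < c by rewrite lt_neqAle eq_sym c1.
rewrite -lee_pdivlMl//.
suff : (\esum_(x in setT) f x <= c^-1%:E * \esum_(x in setT) (c%:E * f x))%E by [].
have : (\esum_(x in setT) (c^-1%:E * (c%:E * f x)) <=
    c^-1%:E * \esum_(x in setT) (c%:E * f x))%E.
  apply: H; first by rewrite invr_ge0 ltW.
  by move=> x; rewrite mule_ge0// lee_fin ltW.
apply: le_trans; apply: le_esum => x _.
by rewrite muleA -EFinM mulVf ?gt_eqF// mul1e.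
Qed.

Lemma l1Z (T : choiceType) (c : R) (f : T -> R) :
  l1 (fun x => c * f x)%R = (`|c|%:E * l1 f)%E.
Proof.
rewrite !l1E -esumZ//.
by apply: eq_esum => x _; rewrite normrM EFinM.
Qed.

Lemma l1Z_fin (T : choiceType) (c : R) (f : T -> R) : (l1 f < +oo)%E ->
  (l1 (fun x => c * f x)%R < +oo)%E.
Proof.
move=> sf; rewrite l1Z; apply: lte_mul_pinfty => //.
Qed.

Lemma l1_fin_num (T : choiceType) (f : T -> R) :
  (l1 f < +oo)%E -> l1 f \is a fin_num.
Proof. by move=> ?; rewrite ge0_fin_numE// l1_ge0. Qed.

(** [rsum] is defined by positive and negative parts, which are not additive. Any splitting into two
    nonnegative summable families gives the same value, and linearity follows from this freedom. *)
Lemma usum_sub (T : choiceType) (f g : T -> R) :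
  (l1 f < +oo)%E -> (l1 g < +oo)%E ->
  (forall x, 0 <= f x) -> (forall x, 0 <= g x) ->
  usum (fun x => f x - g x) = fine (l1 f) - fine (l1 g).
Proof.
move=> sf sg f0 g0; rewrite !usum_rsum /rsum.
have := @esumB R T setT (EFin \o f) (EFin \o g) _ _ _ _; rewrite /summable.
have -> : (\esum_(x in setT) `|(EFin \o f) x|)%E = l1 f by rewrite l1E.
have -> : (\esum_(x in setT) `|(EFin \o g) x|)%E = l1 g by rewrite l1E.
move=> /(_ sf sg).
have esumE h : (forall x : T, 0 <= h x) -> esum setT (EFin \o h) = l1 h.
  by move=> h0; rewrite l1E; apply: eq_esum => x _ /=; rewrite ger0_norm.
rewrite (esumE f f0) (esumE g g0).
set P := fun x => f x - g x.
have -> : (\esum_(i in setT) ((EFin \o f) \- (EFin \o g))^\+ i)%E =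
          (\esum_(x in [set: T]) (P^\+ x)%R%:E)%E.
  by apply: eq_esum => x _; rewrite funeposE /funrpos /P /= -EFinB EFin_max.
have -> : (\esum_(i in setT) ((EFin \o f) \- (EFin \o g))^\- i)%E =
          (\esum_(x in [set: T]) (P^\- x)%R%:E)%E.
  by apply: eq_esum => x _; rewrite funenegE /funrneg /P /= EFin_max EFinN EFinB.
have sP : (l1 P < +oo)%E.
  by apply: l1D_fin; rewrite ?l1N.
have Pp : (\esum_(x in [set: T]) (P^\+ x)%R%:E)%E \is a fin_num.
  rewrite ge0_fin_numE; last by apply: esum_ge0 => x _; rewrite lee_fin.
  apply: le_lt_trans sP; rewrite l1E; apply: le_esum => x _; rewrite lee_fin /funrpos.
  by rewrite ge_max normr_ge0 ler_norm.
have Pn : (\esum_(x in [set: T]) (P^\- x)%R%:E)%E \is a fin_num.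
  rewrite ge0_fin_numE; last by apply: esum_ge0 => x _; rewrite lee_fin.
  apply: le_lt_trans sP; rewrite l1E; apply: le_esum => x _; rewrite lee_fin /funrneg.
  by rewrite ge_max normr_ge0 -normrN ler_norm.
move=> H; have {}H := H (fun x _ => f0 x) (fun x _ => g0 x).
by rewrite -(fineB Pp Pn) H fineB// l1_fin_num.
Qed.

Lemma usum0 (T : choiceType) : usum (fun _ : T => 0) = 0.
Proof.
have l0 : l1 (fun _ : T => 0 : R)%R = 0%E by rewrite l1E; apply: esum1 => x _; rewrite normr0.
have := @usum_sub T (fun=> 0) (fun=> 0); rewrite l0 subrr => H.
by rewrite -[RHS]H//; congr usum; apply/funext => x; rewrite subrr.
Qed.

Lemma usum_ge0E (T : choiceType) (f : T -> R) :
  (l1 f < +oo)%E -> (forall x, 0 <= f x) -> usum f = fine (l1 f).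
Proof.
move=> sf f0.
have l0 : l1 (fun _ : T => 0 : R)%R = 0%E by rewrite l1E; apply: esum1 => x _; rewrite normr0.
have := @usum_sub T f (fun=> 0); rewrite l0 subr0 => <- //.
by congr usum; apply/funext => x; rewrite subr0.
Qed.

Lemma posneg (T : choiceType) (f : T -> R) : exists p n : T -> R,
  [/\ forall x, 0 <= p x, forall x, 0 <= n x, forall x, `|p x| <= `|f x|,
      forall x, `|n x| <= `|f x| & forall x, f x = p x - n x].
Proof.
exists (fun x => Num.max (f x) 0), (fun x => Num.max (- f x) 0).
split=> x; rewrite /Num.max; case: (ltrP (f x) 0) => h;
  case: (ltrP (- f x) 0) => h'; rewrite ?normr0 ?normrN ?normr_ge0//; lra.
Qed.

Lemma posneg_l1 (T : choiceType) (f : T -> R) : (l1 f < +oo)%E ->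
  exists p n : T -> R,
  [/\ forall x, 0 <= p x, forall x, 0 <= n x, (l1 p < +oo)%E, (l1 n < +oo)%E &
      f = (fun x => p x - n x)].
Proof.
move=> sf; have [p [n [p0 n0 pf nf fE]]] := posneg f.
exists p, n; split => //; last exact/funext.
- exact: le_lt_trans (le_l1 pf) sf.
- exact: le_lt_trans (le_l1 nf) sf.
Qed.

Lemma fineD_l1 (T : choiceType) (f g : T -> R) :
  (l1 f < +oo)%E -> (l1 g < +oo)%E ->
  (forall x, 0 <= f x) -> (forall x, 0 <= g x) ->
  fine (l1 (fun x => f x + g x)%R) = fine (l1 f) + fine (l1 g).
Proof.
move=> sf sg f0 g0; rewrite -fineD; [|exact: l1_fin_num|exact: l1_fin_num].
rewrite !l1E -esumD//.
by congr fine; apply: eq_esum => x _; rewrite !ger0_norm ?addr_ge0.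
Qed.

Lemma usumD (T : choiceType) (f g : T -> R) :
  (l1 f < +oo)%E -> (l1 g < +oo)%E ->
  usum (fun x => f x + g x) = usum f + usum g.
Proof.
move=> /posneg_l1[p [n [p0 n0 sp sn ->]]] /posneg_l1[q [m [q0 m0 sq lm ->]]].
rewrite (usum_sub sp sn p0 n0) (usum_sub sq lm q0 m0).
transitivity (usum (fun x => (p x + q x) - (n x + m x))).
  by congr usum; apply/funext => x; ring.
rewrite usum_sub; [|exact: l1D_fin|exact: l1D_fin|
  by move=> x; apply: addr_ge0|by move=> x; apply: addr_ge0].
rewrite (fineD_l1 sp sq p0 q0) (fineD_l1 sn lm n0 m0); ring.
Qed.

Lemma usumN (T : choiceType) (f : T -> R) :
  (l1 f < +oo)%E -> usum (fun x => - f x) = - usum f.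
Proof.
move=> /posneg_l1[p [n [p0 n0 sp sn ->]]].
rewrite (usum_sub sp sn p0 n0) opprB -usum_sub//.
by congr usum; apply/funext => x; ring.
Qed.

Lemma usumB (T : choiceType) (f g : T -> R) :
  (l1 f < +oo)%E -> (l1 g < +oo)%E ->
  usum (fun x => f x - g x) = usum f - usum g.
Proof. by move=> sf sg; rewrite usumD ?l1N// usumN. Qed.

Lemma usumZ (T : choiceType) (c : R) (f : T -> R) :
  (l1 f < +oo)%E -> usum (fun x => c * f x) = c * usum f.
Proof.
move=> sf.
have H d : 0 <= d -> usum (fun x => d * f x) = d * usum f.
  move=> d0; have [p [n [p0 n0 sp sn ->]]] := posneg_l1 sf.
  transitivity (usum (fun x => d * p x - d * n x)).
    by congr usum; apply/funext => x; ring.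
  have dp x : 0 <= d * p x by exact: mulr_ge0.
  have dn x : 0 <= d * n x by exact: mulr_ge0.
  rewrite (usum_sub (l1Z_fin d sp) (l1Z_fin d sn) dp dn) (usum_sub sp sn p0 n0).
  rewrite !l1Z !fineM ?l1_fin_num//= ger0_norm//.
  by rewrite mulrBr.
have [/H //|c0] := leP 0 c.
transitivity (usum (fun x => - (- c * f x))).
  by congr usum; apply/funext => x; ring.
rewrite usumN; last exact: l1Z_fin.
rewrite H ?oppr_ge0 ?(ltW c0)//; ring.
Qed.

Lemma ler_usum (T : choiceType) (f g : T -> R) :
  (l1 f < +oo)%E -> (l1 g < +oo)%E ->
  (forall x, f x <= g x) -> usum f <= usum g.
Proof.
move=> sf sg fg; rewrite -subr_ge0 -usumB// usum_ge0E//.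
- by apply: fine_ge0; rewrite l1_ge0.
- by apply: l1D_fin; rewrite ?l1N.
- by move=> x; rewrite subr_ge0.
Qed.

Lemma l1_norm (T : choiceType) (f : T -> R) : l1 (fun x => `|f x|)%R = l1 f.
Proof. by rewrite !l1E; apply: eq_esum => x _; rewrite normr_id. Qed.

Lemma ler_norm_usum (T : choiceType) (f : T -> R) (M : R) :
  (l1 f <= M%:E)%E -> `|usum f| <= M.
Proof.
move=> fM; have sf : (l1 f < +oo)%E by apply: le_lt_trans fM (ltry _).
have : `|usum f| <= usum (fun x => `|f x|).
  rewrite ler_norml -usumN ?l1_norm//; apply/andP; split.
    by apply: ler_usum; rewrite ?l1N ?l1_norm// => x; rewrite lerNl -normrN ler_norm.
  by apply: ler_usum; rewrite ?l1N ?l1_norm// => x; rewrite ler_norm.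
move/le_trans; apply; rewrite usum_ge0E ?l1_norm//.
by rewrite -lee_fin fineK ?l1_fin_num.
Qed.

Lemma esum_swap (T I : choiceType) (a : T -> I -> \bar R) :
  (forall i j, 0 <= a i j)%E ->
  (\esum_(i in setT) \esum_(j in setT) a i j =
   \esum_(j in setT) \esum_(i in setT) a i j)%E.
Proof.
move=> a0; rewrite !esum_esum//.
rewrite (@reindex_esum _ _ _ (setT `*`` (fun=> setT)) _ (fun p => (p.2, p.1)))//.
by split=> // [[i j] [i' j'] _ _ [-> ->]//|[i j] _]; exists (j, i).
Qed.

Lemma l1_swap (T I : choiceType) (f : T -> I -> R) :
  (\esum_(i in setT) l1 (f i) = \esum_(j in setT) l1 (fun i => f i j)%R)%E.
Proof.
under eq_esum do rewrite l1E.
under [RHS]eq_esum do rewrite l1E.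
by rewrite esum_swap.
Qed.

Lemma le_esum_fin (T : choiceType) (g : T -> \bar R) x :
  (forall x, 0 <= g x)%E ->
  (g x <= \esum_(i in setT) g i)%E.
Proof.
move=> g0; apply: esum_ge; exists [set x]; first by split.
by rewrite fsbig_set1.
Qed.

Lemma le_norm_l1 (T : choiceType) (f : T -> R) x : (`|f x|%:E <= l1 f)%E.
Proof. by rewrite l1E; apply: (@le_esum_fin _ (fun x => `|f x|%:E)) => y; rewrite lee_fin. Qed.

Lemma ge0_fine_l1_l1 (T I : choiceType) (f : T -> I -> R) :
  (\esum_(i in setT) l1 (f i) < +oo)%E ->
  l1 (fun i => fine (l1 (f i)))%R = (\esum_(i in setT) l1 (f i))%E.
Proof.
move=> sf; rewrite l1E; apply: eq_esum => i _.
rewrite ger0_norm ?fine_ge0 ?l1_ge0// fineK// l1_fin_num//.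
by apply: le_lt_trans sf; apply: le_esum_fin => j; apply: l1_ge0.
Qed.

Lemma l1_row_fin (T I : choiceType) (f : T -> I -> R) i :
  (\esum_(i in setT) l1 (f i) < +oo)%E -> (l1 (f i) < +oo)%E.
Proof.
move=> sf; apply: le_lt_trans sf.
by apply: (@le_esum_fin _ (fun i => l1 (f i))) => j; apply: l1_ge0.
Qed.

Lemma l1_usum (T I : choiceType) (f : T -> I -> R) :
  (\esum_(i in setT) l1 (f i) < +oo)%E ->
  (l1 (fun i => usum (f i))%R <= \esum_(i in setT) l1 (f i))%E.
Proof.
move=> sf; rewrite -ge0_fine_l1_l1//; apply: le_l1 => i.
rewrite [leRHS]ger0_norm ?fine_ge0 ?l1_ge0//.
apply: ler_norm_usum; rewrite fineK// l1_fin_num//.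
by apply: le_lt_trans sf; apply: le_esum_fin => j; apply: l1_ge0.
Qed.

Lemma l1_usum_fin (T I : choiceType) (f : T -> I -> R) :
  (\esum_(i in setT) l1 (f i) < +oo)%E -> (l1 (fun i => usum (f i))%R < +oo)%E.
Proof. by move=> sf; apply: le_lt_trans (l1_usum sf) sf. Qed.

(** For nonnegative entries both sides are the same nonnegative double sum; the general case
    subtracts the positive and negative parts. *)
Lemma usum_swap (T I : choiceType) (f : T -> I -> R) :
  (\esum_(i in setT) l1 (f i) < +oo)%E ->
  usum (fun i => usum (f i)) = usum (fun j => usum (fun i => f i j)).
Proof.
have H (A B : choiceType) (g : A -> B -> R) : (forall i j, 0 <= g i j) ->
    (\esum_(i in setT) l1 (g i) < +oo)%E ->
    usum (fun i => usum (g i)) = fine (\esum_(i in setT) l1 (g i))%E.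
  move=> g0 sg; rewrite -ge0_fine_l1_l1//.
  have gi i : (l1 (g i) < +oo)%E by exact: l1_row_fin sg.
  rewrite -[RHS]usum_ge0E.
  - by congr usum; apply/funext => i; rewrite usum_ge0E.
  - by rewrite ge0_fine_l1_l1.
  - by move=> i; rewrite fine_ge0 ?l1_ge0.
have H0 (g : T -> I -> R) : (forall i j, 0 <= g i j) ->
    (\esum_(i in setT) l1 (g i) < +oo)%E ->
    usum (fun i => usum (g i)) = usum (fun j => usum (fun i => g i j)).
  move=> g0 sg; rewrite (H _ _ g g0 sg) l1_swap.
  rewrite (H _ _ (fun j i => g i j) (fun j i => g0 i j))//.
  by rewrite l1_swap in sg.
move=> sf.
have /choice[p pP] i := posneg (f i).
have /choice[n nP] i := pP i.
have p0 i j : 0 <= p i j by have [] := nP i.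
have n0 i j : 0 <= n i j by have [] := nP i.
have sp : (\esum_(i in setT) l1 (p i) < +oo)%E.
  by apply: le_lt_trans sf; apply: le_esum => i _; apply: le_l1; have [] := nP i.
have sn : (\esum_(i in setT) l1 (n i) < +oo)%E.
  by apply: le_lt_trans sf; apply: le_esum => i _; apply: le_l1; have [] := nP i.
have sp' := sp; rewrite l1_swap in sp'.
have sn' := sn; rewrite l1_swap in sn'.
have -> : f = (fun i j => p i j - n i j).
  by apply/funext => i; apply/funext => j; have [_ _ _ _ ->] := nP i.
transitivity (usum (fun i => usum (p i) - usum (n i))).
  congr usum; apply/funext => i.
  exact: usumB (l1_row_fin i sp) (l1_row_fin i sn).
transitivity (usum (fun j => usum (fun i => p i j) - usum (fun i => n i j))); last first.
  congr usum; apply/funext => j; apply/esym.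
  exact: usumB (@l1_row_fin _ _ (fun j i => p i j) j sp')
             (@l1_row_fin _ _ (fun j i => n i j) j sn').
rewrite (usumB (l1_usum_fin sp) (l1_usum_fin sn)) (H0 p p0 sp) (H0 n n0 sn).
by rewrite (usumB (l1_usum_fin sp') (l1_usum_fin sn')).
Qed.

Lemma l1_reindex (T I : choiceType) (e : T -> I) (f : I -> R) :
  bijective e -> l1 (fun x => f (e x))%R = l1 f.
Proof.
move=> [g eK gK]; rewrite !l1E (@reindex_esum _ _ _ setT setT e)//.
split=> // [x y _ _ /(congr1 g)|y _]; first by rewrite !eK.
by exists (g y).
Qed.

Lemma usum_reindex (T I : choiceType) (e : T -> I) (f : I -> R) :
  bijective e -> usum (fun x => f (e x)) = usum f.
Proof.
move=> be; rewrite !usum_rsum /rsum.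
have eb : set_bij setT setT e.
  case: be => g eK gK.
  split=> // [x y _ _ /(congr1 g)|y _]; first by rewrite !eK.
  by exists (g y).
by congr (fine _ - fine _); rewrite [RHS](@reindex_esum _ _ _ setT _ e).
Qed.

Lemma rsum_mkcond (T : choiceType) (D : set T) (f : T -> R) :
  rsum D f = usum (fun x => if x \in D then f x else 0).
Proof.
rewrite !usum_rsum /rsum; congr (fine _ - fine _); rewrite esum_mkcond; apply: eq_esum => x _.
  by rewrite /funrpos; case: ifP => //; rewrite maxxx.
by rewrite /funrneg; case: ifP => //; rewrite oppr0 maxxx.
Qed.

Lemma esum_abs_mkcond (T : choiceType) (D : set T) (f : T -> R) :
  (\esum_(x in D) `|f x|%:E)%E = l1 (fun x => if x \in D then f x else 0)%R.
Proof.
rewrite l1E esum_mkcond; apply: eq_esum => x _.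
by case: ifP => //; rewrite normr0.
Qed.

Lemma l1_finsupp (T : choiceType) (s : seq T) (f : T -> R) : uniq s ->
  (forall x, x \notin s -> f x = 0) -> l1 f = (\sum_(x <- s) `|f x|)%:E.
Proof.
move=> us f0; rewrite -sumEFin l1E.
rewrite fsbig_seq// -esum_fset//.
rewrite [RHS]esum_mkcond; apply: eq_esum => x _.
by case: ifPn => //; rewrite mem_setE => /f0 ->; rewrite normr0.
Qed.

Lemma l1_finsupp_fin (T : choiceType) (s : seq T) (f : T -> R) :
  (forall x, x \notin s -> f x = 0) -> (l1 f < +oo)%E.
Proof.
move=> f0; rewrite (@l1_finsupp _ (undup s)) ?undup_uniq ?ltry// => x.
by rewrite mem_undup; apply: f0.
Qed.

Lemma usum_finsupp (T : choiceType) (s : seq T) (f : T -> R) : uniq s ->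
  (forall x, x \notin s -> f x = 0) -> usum f = \sum_(x <- s) f x.
Proof.
move=> us f0; have [p [n [p0 n0 pf nf fE]]] := posneg f.
have p1 x : x \notin s -> p x = 0.
  by move=> /f0 fx; apply/eqP; rewrite -normr_le0; have := pf x; rewrite fx normr0.
have n1 x : x \notin s -> n x = 0.
  by move=> /f0 fx; apply/eqP; rewrite -normr_le0; have := nf x; rewrite fx normr0.
have -> : f = (fun x => p x - n x) by exact/funext.
rewrite usum_sub ?(l1_finsupp_fin p1) ?(l1_finsupp_fin n1)//.
rewrite (l1_finsupp us p1) (l1_finsupp us n1) /= -sumrB.
by apply: eq_bigr => x _; rewrite !ger0_norm.
Qed.

Lemma usum_single (T : choiceType) (x0 : T) (f : T -> R) :
  (forall x, x != x0 -> f x = 0) -> usum f = f x0.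
Proof.
move=> f0; rewrite (@usum_finsupp _ [:: x0])// ?big_seq1// => x.
by rewrite inE; apply: f0.
Qed.

Lemma l1_single (T : choiceType) (x0 : T) (f : T -> R) :
  (forall x, x != x0 -> f x = 0) -> l1 f = `|f x0|%:E.
Proof.
move=> f0; rewrite (@l1_finsupp _ [:: x0])// ?big_seq1// => x.
by rewrite inE; apply: f0.
Qed.

Lemma l1_sub_seq (T : choiceType) (s : seq T) (f : T -> R) : uniq s ->
  ((\sum_(x <- s) `|f x|)%:E <= l1 f)%E.
Proof.
move=> us; pose g x := if x \in s then f x else 0.
have <- : l1 g = (\sum_(x <- s) `|f x|)%:E.
  rewrite (@l1_finsupp _ s)//; last by move=> x; rewrite /g => /negbTE ->.
  by congr _%:E; apply: eq_big_seq => x xs; rewrite /g xs.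
by apply: le_l1 => x; rewrite /g; case: ifP => //; rewrite normr0.
Qed.

Lemma l1_le_seq (T : choiceType) (f : T -> R) (M : R) :
  (forall s, uniq s -> \sum_(x <- s) `|f x| <= M) -> (l1 f <= M%:E)%E.
Proof.
move=> H; rewrite l1E; apply: ge_ereal_sup => _ [X [finX _] <-].
rewrite fsbig_finite//= sumEFin lee_fin; apply: H.
exact: finmap.fset_uniq.
Qed.

Lemma l1_split (T : choiceType) (p : pred T) (f : T -> R) :
  l1 f = (l1 (fun x => if p x then f x else 0)%R +
          l1 (fun x => if p x then 0 else f x)%R)%E.
Proof.
rewrite !l1E -esumD//; apply: eq_esum => x _.
by case: ifP => _; rewrite normr0 ?adde0 ?add0e.
Qed.

(** The source of all later reductions to finitely many points: what lies off the list is an error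
    of small norm. *)
Lemma l1_tail (T : choiceType) (f : T -> R) (e : R) : (l1 f < +oo)%E -> 0 < e ->
  exists2 s, uniq s & (l1 (fun x => if x \in s then 0 else f x)%R <= e%:E)%E.
Proof.
move=> sf e0.
have := l1_fin_num sf; rewrite l1E => fn.
have [x [X [finX _] <- xl]] := ub_ereal_sup_adherent e0 fn.
exists (finmap.enum_fset (fset_set X)); first exact: finmap.fset_uniq.
move: xl; rewrite fsbig_finite//= sumEFin => xl.
set s := (X in \sum_(_ <- X) _) in xl *.
have := l1_split (mem s) f.
have -> : l1 (fun x => if mem s x then f x else 0)%R = (\sum_(x <- s) `|f x|)%:E.
  rewrite (@l1_finsupp _ s) ?finmap.fset_uniq//; last by move=> y /= /negbTE ->.
  by congr _%:E; apply: eq_big_seq => y ys /=; rewrite ys.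
have {xl} : (l1 f - e%:E < (\sum_(x <- s) `|f x|)%:E)%E by rewrite l1E.
rewrite -l1E in fn; move=> xl splitE; rewrite splitE in xl.
move: xl fn; rewrite splitE; case: (l1 _) (l1_ge0 (fun x => if mem s x then 0 else f x)) => //= r r0.
rewrite -!EFinD lte_fin lee_fin => h _; lra.
Qed.

(** The bridge from unordered sums to the ordered series in [discrete_repr] and in the definitions
    of the exponential, cosine and sine. *)
Lemma usum_nat_cvg (f : nat -> R) : (l1 f < +oo)%E -> series f @ \oo --> usum f.
Proof.
move=> sf; apply/cvgrPdist_le => e e0.
have [s us sl] := l1_tail sf e0.
near=> n.
have sn : forall k, k \in s -> (k < n)%N.
  have : (\max_(k <- s) k < n)%N by near: n; exists (\max_(k <- s) k).+1.
  move=> mn k ks; apply: leq_ltn_trans mn.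
  by rewrite (big_rem k)//= leq_maxl.
rewrite /series /=.
rewrite (_ : \sum_(0 <= k < n) f k = usum (fun k => if (k < n)%N then f k else 0)); last first.
  rewrite (@usum_finsupp _ (index_iota 0 n)) ?iota_uniq//.
    by apply: eq_big_seq => k; rewrite mem_index_iota /= => ->.
  by move=> k; rewrite mem_index_iota /= => /negbTE ->.
have l1n : (l1 (fun k => if (k < n)%N then f k else 0)%R < +oo)%E.
  by apply: le_lt_trans sf; apply: le_l1 => k; case: ifP => //; rewrite normr0.
rewrite -usumB//; apply: ler_norm_usum; apply: le_trans sl; apply: le_l1 => k.
case: ifP => [kn|/negbT kn]; first by rewrite subrr normr0.
by rewrite ifN ?subr0//; apply: contra kn => /sn.
Unshelve. all: end_near. Qed.

Lemma l1_nat_peel (f : nat -> R) : l1 f = (`|f 0%N|%:E + l1 (fun k => f k.+1)%R)%E.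
Proof.
rewrite {1}(l1_split (pred1 0%N) f); congr (_ + _)%E.
  by rewrite (@l1_single _ 0%N) => //= k /negbTE ->.
rewrite !l1E -(@esum_image _ _ _ setT succn (fun k => `|if k == 0%N then 0 else f k|%:E)).
  rewrite [RHS]esum_mkcond; apply: eq_esum => -[|k] _ /=.
    by rewrite normr0; case: ifP.
  by rewrite mem_set//; exists k.
by move=> x y _ _ [].
Qed.

Lemma usum_nat_peel (f : nat -> R) : (l1 f < +oo)%E ->
  usum f = f 0%N + usum (fun k => f k.+1).
Proof.
move=> sf; have sS : (l1 (fun k => f k.+1)%R < +oo)%E.
  by apply: le_lt_trans sf; rewrite [leRHS]l1_nat_peel leeDr.
have H : series f n.+1 @[n --> \oo] --> usum f.
  by rewrite (cvg_shiftS (series f)); exact: usum_nat_cvg.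
have G : series f n.+1 @[n --> \oo] --> f 0%N + usum (fun k => f k.+1).
  rewrite (_ : (fun n => _) = (fun n => f 0%N + series (fun k => f k.+1) n)).
    by apply: cvgD; [exact: cvg_cst|exact: usum_nat_cvg].
  by apply/funext => n; rewrite /series /= big_nat_recl.
exact: (cvg_unique (@Rhausdorff R) H G).
Qed.

End Sums.

(** * Complex sums and the complex exponential *)

Section ComplexSums.
Local Open Scope complex_scope.
Context {R : realType}.
Implicit Types z w : R[i].

Lemma normc_ge0 z : 0 <= normc z.
Proof. by case: z => a b; exact: sqrtr_ge0. Qed.

Lemma normc_abs z : (normc z)%:C = `|z|.
Proof. by case: z. Qed.

Lemma normcD z w : normc (z + w) <= normc z + normc w.
Proof. exact: le_normcD. Qed.

Lemma normcB z w : normc (z - w) <= normc z + normc w.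
Proof. by rewrite -(normcN w); exact: normcD. Qed.

Lemma normc_real (x : R) : normc x%:C = `|x|.
Proof. by rewrite /= expr0n /= addr0 sqrtr_sqr. Qed.

Lemma normcX z n : normc (z ^+ n) = normc z ^+ n.
Proof.
elim: n => [|n IH]; first by rewrite !expr0 normc1.
by rewrite !exprS normcM IH.
Qed.

Lemma normc_Re z : `|complex.Re z| <= normc z.
Proof. by case: z => a b /=; rewrite -sqrtr_sqr ler_wsqrtr// lerDl sqr_ge0. Qed.

Lemma normc_Im z : `|complex.Im z| <= normc z.
Proof. by case: z => a b /=; rewrite -sqrtr_sqr ler_wsqrtr// lerDr sqr_ge0. Qed.

Lemma ReE z w : complex.Re (z * w) =
  complex.Re z * complex.Re w - complex.Im z * complex.Im w.
Proof. by case: z w => [a b] [c d]. Qed.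

Lemma ImE z w : complex.Im (z * w) =
  complex.Re z * complex.Im w + complex.Im z * complex.Re w.
Proof. by case: z w => [a b] [c d]. Qed.

Lemma ReD z w : complex.Re (z + w) = complex.Re z + complex.Re w.
Proof. by case: z w => [a b] [c d]. Qed.

Lemma ImD z w : complex.Im (z + w) = complex.Im z + complex.Im w.
Proof. by case: z w => [a b] [c d]. Qed.

Lemma complexP z w :
  complex.Re z = complex.Re w -> complex.Im z = complex.Im w -> z = w.
Proof. by case: z w => [a b] [c d] /= -> ->. Qed.

Lemma normc_sqr z : (normc z ^+ 2)%:C = z * conjc z.
Proof. by rewrite -sqr_normc -normc_abs rmorphXn. Qed.

Lemma normc_conjc z : normc (conjc z) = normc z.
Proof. by case: z => a b /=; rewrite sqrrN. Qed.

Lemma normc_eq0 z : (normc z == 0) = (z == 0).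
Proof. by apply/eqP/eqP => [/eq0_normc//|->]; rewrite normc0. Qed.

Definition cusum (T : choiceType) (f : T -> R[i]) : R[i] :=
  usum (fun x => complex.Re (f x)) +i* usum (fun x => complex.Im (f x)).

Definition cl1 (T : choiceType) (f : T -> R[i]) : \bar R := l1 (fun x => normc (f x)).

Lemma cl1_Re (T : choiceType) (f : T -> R[i]) :
  (l1 (fun x => complex.Re (f x))%R <= cl1 f)%E.
Proof. by apply: le_l1 => x; rewrite [leRHS]ger0_norm ?normc_ge0// normc_Re. Qed.

Lemma cl1_Im (T : choiceType) (f : T -> R[i]) :
  (l1 (fun x => complex.Im (f x))%R <= cl1 f)%E.
Proof. by apply: le_l1 => x; rewrite [leRHS]ger0_norm ?normc_ge0// normc_Im. Qed.

Lemma cl1_Re_fin (T : choiceType) (f : T -> R[i]) : (cl1 f < +oo)%E ->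
  (l1 (fun x => complex.Re (f x))%R < +oo)%E.
Proof. by apply: le_lt_trans; exact: cl1_Re. Qed.

Lemma cl1_Im_fin (T : choiceType) (f : T -> R[i]) : (cl1 f < +oo)%E ->
  (l1 (fun x => complex.Im (f x))%R < +oo)%E.
Proof. by apply: le_lt_trans; exact: cl1_Im. Qed.

Lemma cl1Z (T : choiceType) (c : R[i]) (f : T -> R[i]) :
  cl1 (fun x => c * f x) = ((normc c)%:E * cl1 f)%E.
Proof.
rewrite /cl1 -[normc c in RHS]ger0_norm ?normc_ge0// -l1Z.
by congr l1; apply/funext => x; rewrite normcM.
Qed.

Lemma cl1_fin_le (T : choiceType) (f : T -> R[i]) (g : T -> R) :
  (l1 g < +oo)%E -> (forall x, normc (f x) <= `|g x|) -> (cl1 f < +oo)%E.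
Proof.
move=> gf fg; apply: le_lt_trans gf; apply: le_l1 => x.
by rewrite [leLHS]ger0_norm ?normc_ge0.
Qed.

Lemma cl1Z_fin (T : choiceType) (c : R[i]) (f : T -> R[i]) :
  (cl1 f < +oo)%E -> (cl1 (fun x => c * f x)%R < +oo)%E.
Proof. by move=> sf; rewrite cl1Z; apply: lte_mul_pinfty; rewrite ?lee_fin ?normc_ge0. Qed.

Lemma cl1N (T : choiceType) (f : T -> R[i]) :
  cl1 (fun x => - f x) = cl1 f.
Proof. by congr l1; apply/funext => x; rewrite normcN. Qed.

Lemma cusumD (T : choiceType) (f g : T -> R[i]) :
  (cl1 f < +oo)%E -> (cl1 g < +oo)%E ->
  cusum (fun x => f x + g x) = cusum f + cusum g.
Proof.
move=> sf sg; apply: complexP; rewrite ?ReD ?ImD /=.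
  rewrite -(usumD (cl1_Re_fin sf) (cl1_Re_fin sg)).
  by congr usum; apply/funext => x; rewrite ReD.
rewrite -(usumD (cl1_Im_fin sf) (cl1_Im_fin sg)).
by congr usum; apply/funext => x; rewrite ImD.
Qed.

Lemma cusumZ (T : choiceType) (c : R[i]) (f : T -> R[i]) :
  (cl1 f < +oo)%E -> cusum (fun x => c * f x) = c * cusum f.
Proof.
move=> sf; have [sr si] := conj (cl1_Re_fin sf) (cl1_Im_fin sf).
apply: complexP; rewrite ?ReE ?ImE /=.
  rewrite -(usumZ _ sr) -(usumZ _ si) -(usumB (l1Z_fin _ sr) (l1Z_fin _ si)).
  by congr usum; apply/funext => x; rewrite ReE.
rewrite -(usumZ _ sr) -(usumZ _ si) -(usumD (l1Z_fin _ si) (l1Z_fin _ sr)).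
by congr usum; apply/funext => x; rewrite ImE.
Qed.

Lemma cusumB (T : choiceType) (f g : T -> R[i]) :
  (cl1 f < +oo)%E -> (cl1 g < +oo)%E ->
  cusum (fun x => f x - g x) = cusum f - cusum g.
Proof.
move=> sf sg; rewrite cusumD ?cl1N//; congr (_ + _).
rewrite -[RHS]mulN1r -cusumZ//.
by congr cusum; apply/funext => x; rewrite mulN1r.
Qed.

Lemma cusum_eq0 (T : choiceType) (f : T -> R[i]) : (forall x, f x = 0) -> cusum f = 0.
Proof.
by move=> f0; apply: complexP; rewrite /= -[RHS](usum0 T); congr usum;
  apply/funext => x; rewrite f0.
Qed.

(** Bounding real and imaginary parts separately would lose a constant factor, whereas Wiener's
    lemma below is applied to characteristic functions bounded by exactly 1. *)
Lemma normc_cusum (T : choiceType) (f : T -> R[i]) (M : R) :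
  (cl1 f <= M%:E)%E -> normc (cusum f) <= M.
Proof.
move=> fM; have sf : (cl1 f < +oo)%E by apply: le_lt_trans fM (ltry _).
have [w0|w0] := eqVneq (cusum f) 0.
  by rewrite w0 normc0 -lee_fin; apply: le_trans (l1_ge0 _) fM.
set w := cusum f in w0 *.
have n0 : normc w != 0 by rewrite normc_eq0.
(* rotate the sum onto the positive real axis *)
pose r := conjc w * ((normc w)^-1)%:C.
have rn : normc r = 1.
  rewrite normcM normc_conjc normc_real normrV ?unitfE//.
  by rewrite ger0_norm ?normc_ge0// divff.
have wE : (normc w)%:C = cusum (fun x => r * f x).
  rewrite cusumZ// -/w /r mulrAC [_ * w]mulrC -normc_sqr -rmorphM /=.
  by rewrite expr2 mulfK.
have -> : normc w = complex.Re (cusum (fun x => r * f x)) by rewrite -wE.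
apply: le_trans (ler_norm _) _; apply: ler_norm_usum.
apply: le_trans fM; apply: le_l1 => x.
by rewrite [leRHS]ger0_norm ?normc_ge0// (le_trans (normc_Re _))// normcM rn mul1r.
Qed.

Lemma cusum_swap (T I : choiceType) (f : T -> I -> R[i]) :
  (\esum_(i in setT) cl1 (f i) < +oo)%E ->
  cusum (fun i => cusum (f i)) = cusum (fun j => cusum (fun i => f i j)).
Proof.
move=> sf; apply: complexP => /=.
  apply: usum_swap; apply: le_lt_trans sf; apply: le_esum => i _; exact: cl1_Re.
apply: usum_swap; apply: le_lt_trans sf; apply: le_esum => i _; exact: cl1_Im.
Qed.

Lemma cusum_reindex (T I : choiceType) (e : T -> I) (f : I -> R[i]) :
  bijective e -> cusum (fun x => f (e x)) = cusum f.
Proof.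
by move=> be; apply: complexP; rewrite /= -(usum_reindex _ be).
Qed.

Lemma cusum_finsupp (T : choiceType) (s : seq T) (f : T -> R[i]) : uniq s ->
  (forall x, x \notin s -> f x = 0) -> cusum f = \sum_(x <- s) f x.
Proof.
move=> us f0; rewrite /cusum.
rewrite !(@usum_finsupp _ _ s) //; try by move=> x xs; rewrite f0.
by elim: s {us f0} => [|x s IH]; rewrite ?big_nil// !big_cons -IH; case: (f x).
Qed.

Lemma cusum_single (T : choiceType) (x0 : T) (f : T -> R[i]) :
  (forall x, x != x0 -> f x = 0) -> cusum f = f x0.
Proof.
move=> f0; rewrite (@cusum_finsupp _ [:: x0])// ?big_seq1// => x.
by rewrite inE; apply: f0.
Qed.

Lemma cusum_nat_peel (f : nat -> R[i]) : (cl1 f < +oo)%E ->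
  cusum f = f 0%N + cusum (fun k => f k.+1).
Proof.
move=> sf; apply: complexP; rewrite ?ReD ?ImD /=.
  exact: (usum_nat_peel (cl1_Re_fin sf)).
exact: (usum_nat_peel (cl1_Im_fin sf)).
Qed.

Lemma csum_mkcond (T : choiceType) (D : set T) (f : T -> R[i]) :
  csum D f = cusum (fun x => if x \in D then f x else 0).
Proof.
rewrite /csum !rsum_mkcond; apply: complexP => /=.
  by congr usum; apply/funext => x; case: ifP.
by congr usum; apply/funext => x; case: ifP.
Qed.

Lemma cusum_real (T : choiceType) (f : T -> R) : cusum (fun x => (f x)%:C) = (usum f)%:C.
Proof. by apply: complexP => //=; exact: usum0. Qed.

Lemma cexpD z w : cexp (z + w) = cexp z * cexp w.
Proof.
case: z w => [a b] [c d]; rewrite /cexp /= expRD cosD sinD.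
apply: complexP; rewrite !(ReE, ImE) /=; ring.
Qed.

Lemma cexp0 : cexp 0 = 1 :> R[i].
Proof. by rewrite /cexp /= expR0 cos0 sin0; apply: complexP; rewrite !(ReE, ImE) /=; ring. Qed.

Lemma cexpN z : cexp (- z) * cexp z = 1.
Proof. by rewrite -cexpD addNr cexp0. Qed.

Lemma normc_cexp z : normc (cexp z) = expR (complex.Re z).
Proof.
rewrite /cexp normcM normc_real ger0_norm ?expR_ge0//=.
by rewrite cos2Dsin2 sqrtr1 mulr1.
Qed.

Definition eit (x t : R) : R[i] := locked_with lock_key (cexp (0 +i* (t * x))).

Lemma eit_cexp (x t : R) : eit x t = cexp (0 +i* (t * x)).
Proof. by rewrite /eit unlock. Qed.

Lemma eitE x t : eit x t = cos (t * x) +i* sin (t * x).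
Proof. by rewrite eit_cexp /cexp /= expR0; apply: complexP; rewrite !(ReE, ImE) /=; ring. Qed.

Lemma normc_eit x t : normc (eit x t) = 1.
Proof. by rewrite eit_cexp normc_cexp /= expR0. Qed.

Lemma eitDx x y t : eit (x + y) t = eit x t * eit y t.
Proof. by rewrite !eit_cexp -cexpD mulrDr; congr cexp; apply: complexP => //=; rewrite addr0. Qed.

Lemma eitDt x s t : eit x (s + t) = eit x s * eit x t.
Proof. by rewrite !eit_cexp -cexpD mulrDl; congr cexp; apply: complexP => //=; rewrite addr0. Qed.

Lemma eit0 t : eit 0 t = 1.
Proof. by rewrite !eit_cexp mulr0 cexp0. Qed.

Lemma eit_t0 x : eit x 0 = 1.
Proof. by rewrite !eit_cexp mul0r cexp0. Qed.

Lemma eitN x t : eit (- x) t = conjc (eit x t).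
Proof. by rewrite !eitE mulrN cosN sinN. Qed.

End ComplexSums.

(** * The Wiener algebra *)

Section Wiener.
Local Open Scope complex_scope.
Context {R : realType}.
Implicit Types (z w : R[i]) (a b : R -> R) (f g : R -> R[i]).

(** Coefficients are real: masses and spectral parameters are, and products, conjugates,
    exponentials and the logarithms built below keep them real. *)
Definition ft a (t : R) : R[i] :=
  locked_with lock_key (cusum (fun x => (a x)%:C * eit x t)).

Lemma ftE a t : ft a t = cusum (fun x => (a x)%:C * eit x t).
Proof. by rewrite /ft unlock. Qed.

(* [f] belongs to the Wiener algebra of absolutely convergent trigonometric
   sums, with norm at most [M]. *)
Definition inA f (M : R) : Prop :=
  exists2 a, (l1 a <= M%:E)%E & forall t, f t = ft a t.

Lemma cl1_ft a t : cl1 (fun x => (a x)%:C * eit x t) = l1 a.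
Proof.
rewrite -(l1_norm a) /cl1; congr l1; apply/funext => x.
by rewrite normcM normc_real normc_eit mulr1.
Qed.

Lemma normc_ft a t M : (l1 a <= M%:E)%E -> normc (ft a t) <= M.
Proof. by move=> aM; rewrite ftE; apply: normc_cusum; rewrite cl1_ft. Qed.

Lemma ftD a b t : (l1 a < +oo)%E -> (l1 b < +oo)%E ->
  ft (fun x => a x + b x) t = ft a t + ft b t.
Proof.
move=> sa sb; rewrite !ftE -cusumD ?cl1_ft//.
by congr cusum; apply/funext => x; rewrite rmorphD mulrDl.
Qed.

Lemma ftZ (c : R) a t : (l1 a < +oo)%E ->
  ft (fun x => c * a x) t = c%:C * ft a t.
Proof.
move=> sa; rewrite !ftE -cusumZ ?cl1_ft//.
by congr cusum; apply/funext => x; rewrite rmorphM mulrA.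
Qed.

Lemma ftB a b t : (l1 a < +oo)%E -> (l1 b < +oo)%E ->
  ft (fun x => a x - b x) t = ft a t - ft b t.
Proof.
move=> sa sb; rewrite !ftE -cusumB ?cl1_ft//.
by congr cusum; apply/funext => x; rewrite rmorphB mulrBl.
Qed.

Lemma ft_finsupp (s : seq R) a t : uniq s -> (forall x, x \notin s -> a x = 0) ->
  ft a t = \sum_(x <- s) (a x)%:C * eit x t.
Proof. by move=> us a0; rewrite ftE; apply: cusum_finsupp => // x /a0 ->; rewrite mul0r. Qed.

Lemma inA_fin f M : inA f M -> exists2 a, (l1 a < +oo)%E & f = ft a.
Proof.
case=> a aM fa; exists a; last exact/funext.
exact: le_lt_trans aM (ltry _).
Qed.

Lemma inA_ge0 f M : inA f M -> 0 <= M.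
Proof. by case=> a aM _; rewrite -lee_fin (le_trans (l1_ge0 a)). Qed.

Lemma inA_le f M N : inA f M -> M <= N -> inA f N.
Proof. by case=> a aM fa MN; exists a => //; apply: le_trans aM _; rewrite lee_fin. Qed.

Lemma normc_inA f M t : inA f M -> normc (f t) <= M.
Proof. by case=> a aM ->; apply: normc_ft. Qed.

Lemma eq_inA f g M : inA f M -> (forall t, f t = g t) -> inA g M.
Proof. by move=> [a aM fa] fg; exists a => // t; rewrite -fg. Qed.

Lemma inA_cl1 (I : choiceType) (f : I -> R -> R[i]) (M : I -> R) (N : R) t :
  (forall i, inA (f i) (M i)) -> (l1 M <= N%:E)%E ->
  (cl1 (fun i => f i t) <= N%:E)%E.
Proof.
move=> fM MN; apply: le_trans MN; apply: le_l1 => i.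
by rewrite !ger0_norm ?(inA_ge0 (fM i)) ?normc_ge0//; apply: normc_inA.
Qed.

(** Completeness of the algebra in the form used for products and for the Neumann, exponential and
    logarithm series. The coefficients of the sum are the sums of the coefficients, by Fubini. *)
Lemma inA_cusum (I : choiceType) (f : I -> R -> R[i]) (M : I -> R) (N : R) :
  (forall i, inA (f i) (M i)) -> (l1 M <= N%:E)%E ->
  inA (fun t => cusum (fun i => f i t)) N.
Proof.
move=> fM MN.
have /choice[a aP] i : exists a, (l1 a <= (M i)%:E)%E /\ forall t, f i t = ft a t.
  by have [a ? ?] := fM i; exists a.
have aN : (\esum_(i in setT) l1 (a i) <= N%:E)%E.
  apply: le_trans MN; rewrite l1E; apply: le_esum => i _.
  by apply: (le_trans (proj1 (aP i))); rewrite lee_fin ler_norm.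
have aoo : (\esum_(i in setT) l1 (a i) < +oo)%E by exact: le_lt_trans aN (ltry _).
have aoo' := aoo; rewrite l1_swap in aoo'.
exists (fun x => usum (fun i => a i x)).
  apply: le_trans aN; rewrite l1_swap.
  exact: (@l1_usum _ _ _ (fun x i => a i x)).
move=> t; rewrite !ftE.
transitivity (cusum (fun i => cusum (fun x => (a i x)%:C * eit x t))).
  by congr cusum; apply/funext => i; rewrite -ftE; have [_ ->] := aP i.
rewrite cusum_swap; last first.
  by rewrite (_ : (fun i => _) = (fun i => l1 (a i)))//; apply/funext => i; rewrite cl1_ft.
congr cusum; apply/funext => x; rewrite -cusum_real mulrC -cusumZ.
  by congr cusum; apply/funext => i; rewrite mulrC.
rewrite (_ : cl1 _ = l1 (fun i => a i x)); last first.
  by rewrite -[RHS]l1_norm; congr l1; apply/funext => i; rewrite normc_real.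
exact: (@l1_row_fin _ _ _ (fun x i => a i x)).
Qed.

Lemma inA_eit x : inA (eit x) 1.
Proof.
exists (fun y => (y == x)%:R).
  rewrite (@l1_single _ _ x) ?eqxx ?normr1// => y /negbTE -> //.
move=> t; rewrite !ftE (@cusum_single _ _ x) ?eqxx ?mul1r// => y /negbTE ->.
by rewrite mul0r.
Qed.

Lemma inAZ (c : R) f M : inA f M -> inA (fun t => c%:C * f t) (`|c| * M).
Proof.
case=> a aM fa; exists (fun x => c * a x).
  by rewrite l1Z EFinM; apply: lee_wpmul2l.
by move=> t; rewrite ftZ ?fa//; apply: le_lt_trans aM (ltry _).
Qed.

Lemma inA_real (c : R) : inA (fun=> c%:C) `|c|.
Proof.
rewrite -[`|c|]mulr1; apply: eq_inA (inAZ c (inA_eit 0)) _ => t.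
by rewrite eit0 mulr1.
Qed.

Lemma inA1 : inA (fun=> 1) 1.
Proof. by have := inA_real 1; rewrite normr1. Qed.

Lemma inAD f g M N : inA f M -> inA g N -> inA (fun t => f t + g t) (M + N).
Proof.
case=> a aM fa [b bN gb]; exists (fun x => a x + b x).
  by apply: le_trans (l1D _ _) _; rewrite EFinD leeD.
by move=> t; rewrite ftD ?fa ?gb//; [exact: le_lt_trans aM (ltry _)|exact: le_lt_trans bN (ltry _)].
Qed.

Lemma inAN f M : inA f M -> inA (fun t => - f t) M.
Proof.
move=> /(inAZ (-1)); rewrite normrN1 mul1r => /eq_inA; apply => t.
by rewrite rmorphN mulN1r.
Qed.

Lemma inAB f g M N : inA f M -> inA g N -> inA (fun t => f t - g t) (M + N).
Proof. by move=> fM gN; apply: inAD => //; apply: inAN. Qed.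

Lemma inA_shift x f M : inA f M -> inA (fun t => eit x t * f t) M.
Proof.
case=> a aM fa; exists (fun y => a (y - x)).
  rewrite (@l1_reindex _ _ _ (fun y => y - x))//.
  by exists (fun y => y + x) => y; rewrite ?subrK ?addrK.
move=> t; rewrite fa !ftE -cusumZ; last by rewrite cl1_ft; apply: le_lt_trans aM (ltry _).
rewrite -[RHS](@cusum_reindex _ _ _ (fun y => y + x)); last first.
  by exists (fun y => y - x) => y; rewrite ?subrK ?addrK.
by congr cusum; apply/funext => y; rewrite addrK eitDx; ring.
Qed.

(** The product is the sum over [x] of [a x] times the shift of [g] by the frequency [x], so no
    explicit convolution appears. *)
Lemma inAM f g M N : inA f M -> inA g N -> inA (fun t => f t * g t) (M * N).
Proof.
case=> a aM fa gN.
have N0 := inA_ge0 gN.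
have H x : inA (fun t => (a x)%:C * (eit x t * g t)) (`|a x| * N).
  exact: inAZ (inA_shift _ gN).
have HN : (l1 (fun x => `|a x| * N)%R <= (M * N)%:E)%E.
  rewrite (_ : (fun x => _) = (fun x => N * `|a x|)); last first.
    by apply/funext => x; rewrite mulrC.
  rewrite l1Z l1_norm ger0_norm// mulrC EFinM; apply: lee_wpmul2l => //.
apply: eq_inA (inA_cusum H HN) _ => t.
rewrite fa !ftE [RHS]mulrC -cusumZ; last by rewrite cl1_ft; apply: le_lt_trans aM (ltry _).
by congr cusum; apply/funext => x; ring.
Qed.

Lemma inAX f M n : inA f M -> inA (fun t => f t ^+ n) (M ^+ n).
Proof.
move=> fM; elim: n => [|n IH].
  by rewrite expr0; apply: eq_inA inA1 _ => t; rewrite expr0.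
by rewrite exprS; apply: eq_inA (inAM fM IH) _ => t; rewrite exprS.
Qed.

Lemma cusum_conj (T : choiceType) (F : T -> R[i]) : (cl1 F < +oo)%E ->
  conjc (cusum F) = cusum (fun x => conjc (F x)).
Proof.
move=> sF; apply: complexP => /=.
  by congr usum; apply/funext => x; case: (F x).
by rewrite -(usumN (cl1_Im_fin sF)); congr usum; apply/funext => x; case: (F x).
Qed.

(** Since the coefficients are real, conjugation only reflects the frequencies. *)
Lemma inA_conj f M : inA f M -> inA (fun t => conjc (f t)) M.
Proof.
case=> a aM fa; exists (fun y => a (- y)).
  by rewrite (@l1_reindex _ _ _ (fun y => - y))//; exists -%R; exact: opprK.
move=> t; rewrite fa !ftE -[RHS](@cusum_reindex _ _ _ (fun y => - y)); last first.
  by exists -%R; exact: opprK.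
rewrite cusum_conj ?cl1_ft; last by apply: le_lt_trans aM (ltry _).
by congr cusum; apply/funext => x; rewrite opprK eitN rmorphM; congr (_ * _); apply: complexP; rewrite /= ?oppr0.
Qed.

Lemma inA_sum (I : Type) (s : seq I) (f : I -> R -> R[i]) (M : I -> R) :
  (forall i, inA (f i) (M i)) ->
  inA (fun t => \sum_(i <- s) f i t) (\sum_(i <- s) M i).
Proof.
move=> fM; elim: s => [|i s IH].
  rewrite big_nil; have := inA_real 0; rewrite normr0 => /eq_inA; apply => t.
  by rewrite big_nil.
by rewrite big_cons; apply: eq_inA (inAD (fM i) IH) _ => t; rewrite big_cons.
Qed.

(* Averaging t and t + pi/(y - y0) kills the frequency y, keeps the
   coefficient of y0 and does not increase the supremum. *)
Lemma coef_le_finite (s : seq R) (c : R -> R[i]) (y0 : R) (M : R) :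
  y0 \notin s ->
  (forall t, normc (\sum_(y <- y0 :: s) c y * eit y t) <= M) -> normc (c y0) <= M.
Proof.
elim: s c => [|y s IH] c.
  by move=> _ /(_ 0); rewrite big_seq1 normcM normc_eit mulr1.
rewrite inE negb_or => /andP[yy0 ys] H.
pose h := pi / (y - y0).
(* The shifted copy is rotated by [eit (- y0) h]: the factor is then 1 at [y0] and 0 at [y], where
   the phase is [pi]. *)
pose c' (z : R) := c z * ((1 + eit (z - y0) h) / 2).
have <- : c' y0 = c y0.
  by rewrite /c' subrr eit0 -[1 + 1]/(2%:R) divff ?mulr1// pnatr_eq0.
apply: (IH c' ys) => t.
have c'y : c' y = 0.
  rewrite /c' eitE /h mulrAC mulrK ?unitfE ?subr_eq0 1?eq_sym// cospi sinpi.
  by rewrite (_ : 1 + _ = 0) ?mul0r ?mulr0//; apply: complexP => /=; ring.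
have -> : \sum_(z <- y0 :: s) c' z * eit z t =
    (\sum_(z <- y0 :: y :: s) c z * eit z t +
     eit (- y0) h * \sum_(z <- y0 :: y :: s) c z * eit z (t + h)) / 2.
  transitivity (\sum_(z <- y0 :: y :: s) c' z * eit z t).
    by rewrite !big_cons c'y mul0r add0r.
  rewrite mulr_sumr -big_split /= mulr_suml; apply: eq_bigr => z _.
  by rewrite /c' eitDt eitDx; ring.
rewrite normcM normcV (_ : normc 2 = 2); last first.
  by rewrite (_ : 2 = (2 : R)%:C) ?normc_real ?ger0_norm//; rewrite rmorph_nat.
rewrite ler_pdivrMr//; apply: le_trans (normcD _ _) _.
rewrite normcM normc_eit mul1r.
by have := H t; have := H (t + h); lra.
Qed.

(** Truncation to finitely many frequencies changes the supremum by at most the norm [e] of the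
    tail, and [e] is arbitrary. *)
Lemma coef_le a (M x : R) : (l1 a < +oo)%E -> (forall t, normc (ft a t) <= M) ->
  `|a x| <= M.
Proof.
move=> sa H; apply/ler_addgt0Pr => e e0.
have [s us se] := l1_tail sa e0.
(* The frequency [x] has to head the list, whether or not the truncation retained it. *)
pose s' := rem x s.
have us' : uniq (x :: s') by rewrite /= mem_rem_uniqF// rem_uniq.
have ss' y : y \notin x :: s' -> y \notin s.
  apply: contra => ys; rewrite inE; case: eqVneq => //= yx.
  by rewrite mem_rem_uniq// inE /= yx.
pose b y := if y \in x :: s' then a y else 0.
pose r y := if y \in x :: s' then 0 else a y.
have bx : b x = a x by rewrite /b mem_head.
have b0 y : y \notin x :: s' -> b y = 0 by rewrite /b => /negbTE ->.
have sb : (l1 b < +oo)%E by exact: l1_finsupp_fin b0.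
have re : (l1 r <= e%:E)%E.
  apply: le_trans se; apply: le_l1 => y; rewrite /r.
  by case: ifPn => [_|/ss' /negbTE ->]//; rewrite normr0.
have sr : (l1 r < +oo)%E by apply: le_lt_trans re (ltry _).
rewrite -bx -normc_real; apply: (@coef_le_finite s' (fun y => (b y)%:C)).
  by case/andP: us'.
move=> t; rewrite -(ft_finsupp _ us' b0).
have -> : ft b t = ft a t - ft r t.
  rewrite (_ : b = fun y => a y - r y); first exact: ftB.
  by apply/funext => y; rewrite /b /r; case: ifP; rewrite ?subr0 ?subrr.
by apply: le_trans (normcB _ _) _; apply: lerD (H t) (normc_ft _ re).
Qed.

(** The bound [coef_le] with [M = 0], applied to the difference. *)
Lemma ft_inj a b : (l1 a < +oo)%E -> (l1 b < +oo)%E ->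
  (forall t, ft a t = ft b t) -> a = b.
Proof.
move=> sa sb ab; apply/funext => x; apply/eqP.
rewrite -subr_eq0 -normr_le0.
apply: (@coef_le (fun x => a x - b x)); first by apply: l1D_fin; rewrite ?l1N.
by move=> t; rewrite ftB// ab subrr normc0.
Qed.

(** Uniqueness of the coefficients turns an estimate of a function back into one of the family at
    hand. *)
Lemma inA_ft a M : (l1 a < +oo)%E -> inA (ft a) M -> (l1 a <= M%:E)%E.
Proof.
move=> sa [b bM ab]; rewrite (ft_inj sa _ ab)//.
exact: le_lt_trans bM (ltry _).
Qed.

End Wiener.

(** * Wiener's lemma *)

Section WienerInverse.
Local Open Scope complex_scope.
Context {R : realType}.
Implicit Types (z w : R[i]) (a b : R -> R) (f g h : R -> R[i]).

Lemma l1_nat_le (f : nat -> R) (M : R) :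
  (forall n, \sum_(k < n) `|f k| <= M) -> (l1 f <= M%:E)%E.
Proof.
move=> H; apply: l1_le_seq => s us.
pose n := (\max_(k <- s) k).+1.
have sn k : k \in s -> (k < n)%N by move=> ks; rewrite ltnS (big_rem k)//= leq_maxl.
apply: le_trans (H n).
pose g k := if (k < n)%N then f k else 0.
rewrite -lee_fin (_ : \sum_(k <- s) _ = \sum_(k <- s) `|g k|); last first.
  by apply: eq_big_seq => k /sn kn; rewrite /g kn.
apply: le_trans (l1_sub_seq _ us) _.
rewrite (@l1_finsupp _ _ (index_iota 0 n)) ?iota_uniq//; last first.
  by move=> k; rewrite mem_index_iota /g /= => /negbTE ->.
by rewrite big_mkord lee_fin; apply: ler_sum => i _; rewrite /g ltn_ord.
Qed.

Lemma l1_geometric_le (q : R) : 0 <= q -> q < 1 ->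
  (l1 (fun k => q ^+ k)%R <= ((1 - q)^-1)%:E)%E.
Proof.
move=> q0 q1; apply: l1_nat_le => n.
have p : 0 < 1 - q by rewrite subr_gt0.
rewrite (eq_bigr (fun k : 'I_n => q ^+ k)) => [|k _]; last by rewrite ger0_norm ?exprn_ge0.
rewrite -(ler_pM2l p) mulfV ?gt_eqF// -[leLHS]opprK -mulNr opprB -subrX1 opprB.
by rewrite gerBl exprn_ge0.
Qed.

Lemma l1_geometric (q : R) : 0 <= q -> q < 1 -> (l1 (fun k => q ^+ k)%R < +oo)%E.
Proof. by move=> q0 q1; apply: le_lt_trans (l1_geometric_le q0 q1) (ltry _). Qed.

Lemma l1_poly_geometric (N : nat) (q : R) : 0 <= q -> q < 1 ->
  (l1 (fun k => k.+1%:R ^+ N * q ^+ k)%R < +oo)%E.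
Proof.
(* Passing from [q] to a larger ratio makes it positive, so that it has a logarithm even for
   [q = 0]. *)
move=> q0 q1; pose q' := (1 + q) / 2.
have [qq' q'0 q'1] : [/\ q <= q', 0 < q' & q' < 1] by rewrite /q'; split; lra.
pose L := - ln q'.
have L0 : 0 < L by rewrite oppr_gt0 ln_lt0// q'0 q'1.
have q'E : q' = expR (- L) by rewrite opprK lnK.
(* From [1 + v <= expR v] one gets [k + 1 <= s^-1 * expR (s * (k + 1))]. The [N]-th power grows at
   rate [s * N <= L / 2], which consumes at most half of the decay rate [L] of [q']. The successor
   avoids division by 0. *)
pose s := L / 2 / N.+1%:R.
have s0 : 0 < s by rewrite !divr_gt0.
have sN : s * N%:R <= L / 2.
  rewrite /s mulrAC ler_pdivrMr//; apply: ler_wpM2l; rewrite ?ler_nat//.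
  by rewrite divr_ge0 ?ltW.
apply: (@le_lt_trans _ _
  (l1 (fun k => s^-1 ^+ N * expR (L / 2) * expR (- (L / 2)) ^+ k)%R)); last first.
  by apply: l1Z_fin; apply: l1_geometric; rewrite ?expR_ge0// expR_lt1; lra.
apply: le_l1 => k; rewrite !ger0_norm; last 2 first.
- by rewrite !mulr_ge0 ?exprn_ge0 ?expR_ge0 ?invr_ge0 ?ltW.
- by rewrite mulr_ge0 ?exprn_ge0.
have k1 : k.+1%:R <= s^-1 * expR (s * k.+1%:R).
  rewrite -ler_pdivrMl ?invr_gt0// invrK.
  by apply: le_trans (expR_ge1Dx _); rewrite lerDr.
apply: (@le_trans _ _ ((s^-1 * expR (s * k.+1%:R)) ^+ N * q' ^+ k)).
  have ge0 : 0 <= s^-1 * expR (s * k.+1%:R) by rewrite mulr_ge0 ?expR_ge0 ?invr_ge0 ?ltW.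
  by apply: ler_pM; rewrite ?exprn_ge0//; apply: lerXn2r; rewrite ?nnegrE// ltW.
rewrite exprMn -[leLHS]mulrA -[leRHS]mulrA; apply: ler_wpM2l.
  by rewrite exprn_ge0 ?invr_ge0 ?ltW.
rewrite q'E -!expRM_natl -!expRD ler_expR.
have : s * N%:R * k.+1%:R <= L / 2 * k.+1%:R by apply: ler_wpM2r.
rewrite (_ : N%:R * (s * k.+1%:R) = s * N%:R * k.+1%:R); last by ring.
by rewrite -natr1; move: (s * N%:R) => u; nra.
Qed.

(* The frequencies of the [k]-th power of a trigonometric polynomial with
   frequencies [xs]. *)
Fixpoint grid (xs : seq R) (k : nat) : seq R :=
  if xs is x :: xs' then
    [seq x *+ j + y | j <- iota 0 k.+1, y <- grid xs' k] else [:: 0].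

Lemma size_grid xs k : size (grid xs k) = (k.+1 ^ size xs)%N.
Proof.
by elim: xs => //= x xs IH; rewrite size_cat size_map size_allpairs size_iota IH expnS mulSn.
Qed.

Lemma grid_consP x xs k (y0 : R) : reflect
  (exists j y, [/\ (j <= k)%N, y \in grid xs k & y0 = x *+ j + y])
  (y0 \in grid (x :: xs) k).
Proof.
apply: (iffP allpairsP) => [[[j y] [jk yk ->]]|[j [y [jk yk ->]]]].
  have {}jk : j \in iota 0 k.+1 by [].
  by exists j, y; split => //; move: jk; rewrite mem_iota ltnS.
by exists (j, y); split=> //; rewrite mem_iota ltnS.
Qed.

Lemma grid_mono xs k : {subset grid xs k <= grid xs k.+1}.
Proof.
elim: xs => // x xs IH z /grid_consP[j [y [jk yk ->]]].
by apply/grid_consP; exists j, y; split; [exact: leqW|exact: IH|].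
Qed.

Lemma grid0 xs : 0 \in grid xs 0.
Proof.
elim: xs => [|x xs IH]; first by rewrite inE.
by apply/grid_consP; exists 0%N, 0; rewrite mulr0n addr0.
Qed.

Lemma grid_add xs k x y : x \in xs -> y \in grid xs k -> x + y \in grid xs k.+1.
Proof.
elim: xs y => // x' xs IH y; rewrite inE => /predU1P[<-|xxs] /grid_consP[j [w [jk wk ->]]].
  apply/grid_consP; exists j.+1, w; split=> //; first exact: grid_mono.
  by rewrite addrA -mulrS.
apply/grid_consP; exists j, (x + w); split; [exact: leqW|exact: IH|by rewrite addrCA].
Qed.

Definition supported (s : seq R) f : Prop :=
  exists2 c : R -> R, forall x, x \notin s -> c x = 0 & forall t, f t = ft c t.

(** There are at most [size s] coefficients, each at most [M] by [coef_le]. *)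
Lemma supported_inA s f M : supported s f -> (forall t, normc (f t) <= M) ->
  inA f ((size s)%:R * M).
Proof.
move=> [c c0 fc] fM; exists c => //.
have M0 : 0 <= M by apply: le_trans (fM 0); exact: normc_ge0.
rewrite (@l1_finsupp _ _ (undup s)) ?undup_uniq//; last first.
  by move=> x; rewrite mem_undup => /c0.
rewrite lee_fin; apply: (@le_trans _ _ (\sum_(x <- undup s) M)).
  apply: ler_sum => x _; apply: coef_le; first exact: l1_finsupp_fin c0.
  by move=> t; rewrite -fc.
rewrite big_const_seq count_predT iter_addr_0 -[M *+ _]mulr_natl; apply: ler_wpM2r => //.
by rewrite ler_nat size_undup.
Qed.

Lemma supported_shift x s u f : supported s f ->
  (forall y, y \in s -> x + y \in u) -> supported u (fun t => eit x t * f t).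
Proof.
move=> [c c0 fc] su.
have xb : bijective (fun y => y + x) by exists (fun y => y - x) => y; rewrite ?addrK ?subrK.
exists (fun y => c (y - x)).
  move=> y yu; apply: c0; apply: contra yu => /su.
  by rewrite addrC subrK.
move=> t; rewrite fc !ftE -cusumZ; last first.
  by rewrite cl1_ft; apply: l1_finsupp_fin c0.
rewrite -[RHS](cusum_reindex _ xb).
by congr cusum; apply/funext => y; rewrite addrK eitDx; ring.
Qed.

Lemma supportedZ s (c : R) f : supported s f -> supported s (fun t => c%:C * f t).
Proof.
move=> [a a0 fa]; exists (fun x => c * a x) => [x /a0 ->|t]; first by rewrite mulr0.
by rewrite fa ftZ//; exact: l1_finsupp_fin a0.
Qed.

Lemma supported_sum (xs s : seq R) (f : R -> R -> R[i]) :
  (forall x, x \in xs -> supported s (f x)) ->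
  supported s (fun t => \sum_(x <- xs) f x t).
Proof.
elim: xs => [|x xs IH] H.
  exists (fun=> 0) => // t; rewrite big_nil !ftE cusum_eq0// => x.
  by rewrite mul0r.
have [a a0 fa] := H x (mem_head _ _).
have [y yxs|b b0 fb] := IH; first by apply: H; rewrite inE yxs orbT.
exists (fun y => a y + b y) => [y ys|t]; first by rewrite a0// b0// addr0.
rewrite big_cons fa fb ftD//; [exact: l1_finsupp_fin a0|exact: l1_finsupp_fin b0].
Qed.

Lemma supported_pow xs (c : R -> R) k :
  supported (grid xs k) (fun t => (\sum_(x <- xs) (c x)%:C * eit x t) ^+ k).
Proof.
elim: k => [|k IH].
  exists (fun x => (x == 0)%:R) => [x|t].
    by case: eqVneq => // ->; rewrite grid0.
  rewrite expr0 !ftE (@cusum_single _ _ 0) ?eqxx ?eit0 ?mulr1// => x /negbTE ->.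
  by rewrite mul0r.
have [a a0 fa] : supported (grid xs k.+1) (fun t => \sum_(x <- xs)
    (c x)%:C * (eit x t * (\sum_(x <- xs) (c x)%:C * eit x t) ^+ k)).
  apply: supported_sum => x xxs; apply: supportedZ.
  by apply: supported_shift IH _ => y; apply: grid_add.
exists a => // t; rewrite -fa exprS mulr_suml.
by apply: eq_bigr => x _; rewrite mulrA.
Qed.

(* The [l1]-norms of the powers grow no faster than the powers of the
   supremum: up to an arbitrarily small [l1]-perturbation [h] is a
   trigonometric polynomial, and the [k]-th power of a polynomial with [N]
   frequencies has at most [(k + 1) ^ N] coefficients, each bounded by its
   supremum. *)
Lemma inA_pow_summable h M rho : inA h M -> rho < 1 ->
  (forall t, normc (h t) <= rho) ->
  exists2 m : nat -> R, (forall k, inA (fun t => h t ^+ k) (m k)) & (l1 m < +oo)%E.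
Proof.
move=> /inA_fin[a sa ->] rho1 arho.
have rho0 : 0 <= rho by apply: le_trans (arho 0); exact: normc_ge0.
(* Two errors [e] have to fit below 1: the polynomial part has supremum at most [rho + e], and
   expanding the power with the remainder of norm [e] adds another. *)
pose e := (1 - rho) / 3.
have e0 : 0 < e by rewrite /e; lra.
have [s us se] := l1_tail sa e0.
pose b x := if x \in s then a x else 0.
pose r x := if x \in s then 0 else a x.
have b0 x : x \notin s -> b x = 0 by rewrite /b => /negbTE ->.
have sb : (l1 b < +oo)%E by exact: l1_finsupp_fin b0.
have re : (l1 r <= e%:E)%E by exact: se.
have sr : (l1 r < +oo)%E by apply: le_lt_trans re (ltry _).
have abr t : ft a t = ft b t + ft r t.
  rewrite -(ftD t sb sr) (_ : a = fun x => b x + r x)//.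
  by apply/funext => x; rewrite /b /r; case: ifP; rewrite ?addr0 ?add0r.
have bsup t : normc (ft b t) <= rho + e.
  have -> : ft b t = ft a t - ft r t by rewrite abr addrK.
  by apply: le_trans (normcB _ _) _; apply: lerD (arho t) (normc_ft _ re).
have bk k : inA (fun t => ft b t ^+ k) (k.+1%:R ^+ size s * (rho + e) ^+ k).
  rewrite -natrX -size_grid; apply: supported_inA.
    have [c c0 fc] := supported_pow s b k.
    by exists c => // t; rewrite -fc (ft_finsupp _ us b0).
  move=> t; rewrite normcX; apply: lerXn2r; rewrite ?nnegrE ?normc_ge0//.
  by rewrite addr_ge0// ltW.
exists (fun k => k.+1%:R ^+ size s * (rho + e + e) ^+ k); last first.
  by apply: l1_poly_geometric; rewrite /e; lra.
move=> k.
(* The counting factor of the power [k - i] is replaced by the larger one of [k], which is common to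
   all terms; the binomial sum then collapses to [(rho + e + e) ^+ k]. *)
pose m (i : 'I_k.+1) : R := k.+1%:R ^+ size s * ((rho + e) ^+ (k - i) * e ^+ i *+ 'C(k, i)).
have H (i : 'I_k.+1) : inA (fun t => ft b t ^+ (k - i) * ft r t ^+ i *+ 'C(k, i)) (m i).
  have rI : inA (ft r) e by exists r.
  have := inAZ 'C(k, i)%:R (inAM (bk (k - i)%N) (inAX i rI)).
  rewrite ger0_norm// => /inA_le H.
  apply: eq_inA (H _ _) _ => [|t]; last by rewrite rmorph_nat mulr_natl.
  rewrite /m -[X in _ <= _ * X]mulr_natl [leRHS]mulrCA; apply: ler_wpM2l => //.
  rewrite -mulrA; apply: ler_wpM2r.
    by rewrite mulr_ge0 ?exprn_ge0 ?addr_ge0 ?(ltW e0).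
  by apply: lerXn2r; rewrite ?nnegrE// ler_nat ltnS leq_subr.
have := inA_sum (index_enum 'I_k.+1) H.
rewrite /m -mulr_sumr -exprDn => HH.
by apply: eq_inA HH _ => t; rewrite abr exprDn.
Qed.

(** The inverse is the geometric series [S], characterised by [S = 1 + h S]. It lies in the algebra
    because the norms of the powers are summable, even if the norm of [h] itself exceeds 1. *)
Lemma inA_neumann h M rho : inA h M -> rho < 1 ->
  (forall t, normc (h t) <= rho) ->
  exists g N, inA g N /\ forall t, (1 - h t) * g t = 1.
Proof.
move=> hM rho1 hrho; have [m hm lm] := inA_pow_summable hM rho1 hrho.
have mN : (l1 m <= (fine (l1 m))%:E)%E by rewrite fineK// l1_fin_num.
exists (fun t => cusum (fun k => h t ^+ k)), (fine (l1 m)); split.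
  exact: (inA_cusum hm mN).
move=> t; have sh : (cl1 (fun k => h t ^+ k)%R < +oo)%E.
  by apply: le_lt_trans (inA_cl1 t hm mN) (ltry _).
have -> : cusum (fun k => h t ^+ k) = 1 + h t * cusum (fun k => h t ^+ k).
  rewrite {1}(cusum_nat_peel sh) expr0 -cusumZ//.
  by congr (_ + cusum _); apply/funext => k; rewrite exprS.
set c := cusum _.
have cE : c = 1 + h t * c.
  rewrite /c {1}(cusum_nat_peel sh) expr0 -cusumZ//.
  by congr (_ + cusum _); apply/funext => k; rewrite exprS.
rewrite -cE mulrBl mul1r; apply/eqP; rewrite subr_eq -cE//.
Qed.

(* Wiener's lemma: [1 - |f|^2] has supremum at most [1 - mu^2] < 1, hence
   [1 / |f|^2] is given by its Neumann series. *)
Lemma wiener f M mu : inA f M -> 0 < mu ->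
  (forall t, mu <= normc (f t) <= 1) ->
  exists g N, inA g N /\ forall t, f t * g t = 1.
Proof.
move=> fM mu0 fmu.
have mu1 : mu <= 1 by have /andP[] := fmu 0; exact: le_trans.
have hI := inAB inA1 (inAM fM (inA_conj fM)).
have [|t|g [N [gN gE]]] := @inA_neumann _ _ (1 - mu ^+ 2) hI.
- by rewrite gtrBl exprn_gt0.
- rewrite -normc_sqr -[1]/(1%:C) -rmorphB normc_real.
  have /andP[fmu1 fmu2] := fmu t.
  rewrite ger0_norm ?lerD2l ?lerN2 ?subr_ge0.
    by apply: lerXn2r; rewrite ?nnegrE ?normc_ge0// ltW.
  by rewrite expr_le1 ?normc_ge0.
exists (fun t => conjc (f t) * g t), (M * N); split.
  exact: inAM (inA_conj fM) gN.
by move=> t; rewrite -(gE t) mulrA opprB addrC subrK.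
Qed.

End WienerInverse.

(** * Exponentials and logarithms in the Wiener algebra *)

Section ExpLog.
Local Open Scope complex_scope.
Context {R : realType}.
Implicit Types (z w : R[i]) (a b : R -> R) (f g h : R -> R[i]).

Lemma normc_nat n : normc (n%:R : R[i]) = n%:R.
Proof. by rewrite -[n%:R](rmorph_nat (real_complex R)) normc_real ger0_norm. Qed.

Lemma series_exp_le (x : R) n : 0 <= x -> \sum_(k < n) x ^+ k / k`!%:R <= expR x.
Proof.
move=> x0.
have := @nondecreasing_cvgn_le R (series (exp_coeff x)) _ (is_cvg_series_exp_coeff x) n.
rewrite /series /= big_mkord; apply; apply: nondecreasing_series => k _ _.
exact: exp_coeff_ge0.
Qed.

Lemma l1_exp_le (x : R) : 0 <= x -> (l1 (fun k => x ^+ k / k`!%:R)%R <= (expR x)%:E)%E.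
Proof.
move=> x0; apply: l1_nat_le => n; apply: le_trans (series_exp_le n x0).
by apply: ler_sum => k _; rewrite ger0_norm// divr_ge0// exprn_ge0.
Qed.

Lemma cl1_exp z : (cl1 (fun k => z ^+ k / k`!%:R)%R <= (expR (normc z))%:E)%E.
Proof.
apply: le_trans (l1_exp_le (normc_ge0 z)); apply: le_l1 => k.
by rewrite normcM normcV normc_nat normcX.
Qed.

Lemma cl1_exp_fin z : (cl1 (fun k => z ^+ k / k`!%:R)%R < +oo)%E.
Proof. exact: le_lt_trans (cl1_exp z) (ltry _). Qed.

Definition eseries z : R[i] := cusum (fun k => z ^+ k / k`!%:R).

Lemma l1_nat_shift (u : nat -> R) j :
  l1 (fun k => if (j <= k)%N then u (k - j)%N else 0) = l1 u.
Proof.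
elim: j => [|j IH]; first by congr l1; apply/funext => k; rewrite subn0.
by rewrite l1_nat_peel /= normr0 add0e.
Qed.

Lemma cusum_nat_shift (u : nat -> R[i]) j : (cl1 u < +oo)%E ->
  cusum (fun k => if (j <= k)%N then u (k - j)%N else 0) = cusum u.
Proof.
move=> su; elim: j => [|j IH]; first by congr cusum; apply/funext => k; rewrite subn0.
rewrite cusum_nat_peel /= ?add0r//.
rewrite /cl1 (_ : (fun k => _) =
  (fun k => if (j < k)%N then normc (u (k - j.+1)%N) else 0)); last first.
  by apply/funext => k; case: ifP; rewrite ?normc0.
by rewrite (l1_nat_shift (fun k => normc (u k))).
Qed.

(** Cauchy product: the term with exponents [j] and [l] is stored at position [(j, j + l)]. Rows sum
    to multiples of [eseries w], columns to binomial expansions. *)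
Lemma eseriesD z w : eseries (z + w) = eseries z * eseries w.
Proof.
pose g j k := if (j <= k)%N then
  z ^+ j / j`!%:R * (w ^+ (k - j) / (k - j)`!%:R) else 0.
have gE j : g j = (fun k => if (j <= k)%N then
    (fun l => z ^+ j / j`!%:R * (w ^+ l / l`!%:R)) (k - j)%N else 0) by [].
have sg : (\esum_(j in setT) cl1 (g j) < +oo)%E.
  pose C := fine (cl1 (fun k => w ^+ k / k`!%:R)).
  have CE : C%:E = cl1 (fun k => w ^+ k / k`!%:R) by rewrite fineK// l1_fin_num// cl1_exp_fin.
  have -> : (\esum_(j in setT) cl1 (g j) =
      l1 (fun j => C * normc (z ^+ j / j`!%:R))%R)%E.
    rewrite l1E; apply: eq_esum => j _.
    rewrite ger0_norm ?mulr_ge0 ?normc_ge0 ?fine_ge0 ?l1_ge0// mulrC EFinM CE -cl1Z /cl1.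
    rewrite -[RHS](l1_nat_shift _ j); congr l1; apply/funext => k.
    by rewrite /g; case: ifP; rewrite ?normc0.
  by apply: l1Z_fin; apply: cl1_exp_fin.
have sz : cusum (fun j => eseries w * (z ^+ j / j`!%:R)) = eseries w * eseries z.
  exact: cusumZ (cl1_exp_fin z).
have := cusum_swap sg.
have -> : (fun j => cusum (g j)) = (fun j => eseries w * (z ^+ j / j`!%:R)).
  apply/funext => j; rewrite gE (@cusum_nat_shift (fun l => z ^+ j / j`!%:R * (w ^+ l / l`!%:R)) j); last first.
    exact: cl1Z_fin (cl1_exp_fin w).
  by rewrite (cusumZ _ (cl1_exp_fin w)) mulrC.
rewrite sz => H; rewrite [RHS]mulrC H.
congr cusum; apply/funext => k.
rewrite (@cusum_finsupp _ _ (index_iota 0 k.+1)) ?iota_uniq//; last first.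
  by move=> j; rewrite mem_index_iota /g /= ltnS => /negbTE ->.
rewrite addrC exprDn mulr_suml big_mkord; apply: eq_bigr => j _.
rewrite /g -ltnS ltn_ord -(bin_fact (ltn_ord j : (j <= k)%N)) !natrM -mulr_natr.
have f0 n : (n`!%:R : R[i]) != 0 by rewrite pnatr_eq0 -lt0n fact_gt0.
have b0 : ('C(k, j)%:R : R[i]) != 0 by rewrite pnatr_eq0 -lt0n bin_gt0 -ltnS.
by field; rewrite !f0 b0.
Qed.

Lemma eseries_real (x : R) : eseries x%:C = (expR x)%:C.
Proof.
have sx : (l1 (fun k => x ^+ k / k`!%:R)%R < +oo)%E.
  apply: le_lt_trans (cl1_exp_fin x%:C); apply: le_l1 => k.
  by rewrite normcM normcV normc_nat normcX normc_real [leRHS]ger0_norm ?mulr_ge0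
             ?invr_ge0// normrM normrX normfV normr_nat.
rewrite /eseries (_ : (fun k => _) = (fun k => (x ^+ k / k`!%:R)%:C)); last first.
  by apply/funext => k; rewrite rmorphM rmorphXn fmorphV rmorph_nat.
rewrite cusum_real; congr (_%:C).
exact: (cvg_unique (@Rhausdorff R) (usum_nat_cvg sx) (is_cvg_series_exp_coeff x)).
Qed.

Lemma expr_imaginary (y : R) k : (0 +i* y) ^+ k =
  ((~~ odd k)%:R * (-1) ^+ k./2 * y ^+ k) +i*
  ((odd k)%:R * (-1) ^+ k.-1./2 * y ^+ k).
Proof.
elim: k => [|k IH]; first by rewrite !expr0 /=; apply: complexP => /=; rewrite ?mul1r ?mul0r.
rewrite exprS IH; apply: complexP; rewrite ?ReE ?ImE /=.
- case ok : (odd k) => /=; last by rewrite !mul0r mulr0 subr0.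
  have -> : k = k./2.*2.+1 by rewrite -{1}(odd_double_half k) ok.
  by rewrite /= uphalf_double !doubleK !exprS; ring.
- by case: (odd k) => /=; rewrite ?exprS; ring.
Qed.

Lemma eseries_imaginary (y : R) : eseries (0 +i* y) = cos y +i* sin y.
Proof.
have s := cl1_exp_fin (0 +i* y).
have termE k : (0 +i* y) ^+ k / k`!%:R = cos_coeff y k +i* sin_coeff y k.
  rewrite expr_imaginary -(rmorph_nat (real_complex R)) -fmorphV.
  by apply: complexP; rewrite ?ReE ?ImE /= ?mulr0 ?subr0 ?add0r.
apply: complexP => /=.
  rewrite unlock; apply: (cvg_unique (@Rhausdorff R) (usum_nat_cvg (cl1_Re_fin s))).
  rewrite (_ : (fun k => _) = cos_coeff y); last by apply/funext => k; rewrite termE.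
  exact: is_cvg_series_cos_coeff.
rewrite unlock; apply: (cvg_unique (@Rhausdorff R) (usum_nat_cvg (cl1_Im_fin s))).
rewrite (_ : (fun k => _) = sin_coeff y); last by apply/funext => k; rewrite termE.
exact: is_cvg_series_sin_coeff.
Qed.

(** The definition by [expR], [cos] and [sin] does not show that exponentials stay in the algebra;
    the power series does, with a norm bound. *)
Lemma cexpE z : cexp z = cusum (fun k => z ^+ k / k`!%:R).
Proof.
case: z => x y; rewrite -/(eseries _).
rewrite (_ : x +i* y = x%:C + (0 +i* y)); last by apply: complexP; rewrite /= ?addr0 ?add0r.
by rewrite eseriesD eseries_real eseries_imaginary cexpD /cexp /= expR0 cos0 sin0
   !(mulr1, mul1r).
Qed.

(** One has [expR M <= 1 / (1 - M)], and [(1 - M) (1 + M + 2 M^2) = 1 + M^2 (1 - 2 M) >= 1]. *)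
Lemma expR_half_le (M : R) : 0 <= M -> M <= 1 / 2 -> expR M <= 1 + M + 2 * M ^+ 2.
Proof.
move=> M0 M1; have e1 := expR_ge1Dx (- M).
have e2 : expR M * expR (- M) = 1 by rewrite -expRD subrr expR0.
have e3 := expR_gt0 M.
have : expR M * (1 - M) <= 1 by rewrite -[leRHS]e2; apply: ler_wpM2l; rewrite ?expR_ge0.
move: (expR M) e3 => u u0 H; rewrite expr2; nra.
Qed.

(** The exponential series without its first two terms has norm at most [expR M - 1 - M]. *)
Lemma inA_expm1m f M : inA f M -> M <= 1 / 2 ->
  inA (fun t => cexp (f t) - 1 - f t) (2 * M ^+ 2).
Proof.
move=> fM M1; have M0 := inA_ge0 fM.
apply: (@inA_le _ _ (expR M - 1 - M)); last by have := expR_half_le M0 M1; lra.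
pose g k t := (k.+2`!%:R^-1)%:C * f t ^+ k.+2.
have gM k : inA (g k) (k.+2`!%:R^-1 * M ^+ k.+2).
  rewrite -[X in X * _]ger0_norm ?invr_ge0//; exact: inAZ (inAX _ fM).
have lM : (l1 (fun k => k.+2`!%:R^-1 * M ^+ k.+2)%R <= (expR M - 1 - M)%:E)%E.
  have := l1_exp_le M0; rewrite l1_nat_peel l1_nat_peel.
  rewrite expr0 expr1 !divr1 normr1 (ger0_norm M0) addeA -EFinD.
  rewrite -leeBrDl// -EFinB opprD addrA; congr (_ <= _)%E; congr l1.
  by apply/funext => k; rewrite mulrC.
apply: eq_inA (inA_cusum gM lM) _ => t.
have s := cl1_exp_fin (f t).
have s1 : (cl1 (fun k => f t ^+ k.+1 / k.+1`!%:R)%R < +oo)%E.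
  by apply: le_lt_trans s; rewrite /cl1 [leRHS]l1_nat_peel leeDr.
rewrite cexpE (cusum_nat_peel s) (cusum_nat_peel s1) expr0 expr1 !divr1.
have cancel x y : 1 + (x + y) - 1 - x = y :> R[i] by ring.
by rewrite cancel; congr cusum; apply/funext => k; rewrite /g mulrC fmorphV rmorph_nat.
Qed.

Lemma inA_expm1 f M : inA f M -> M <= 1 / 2 ->
  inA (fun t => cexp (f t) - 1) (2 * M).
Proof.
move=> fM M1; have M0 := inA_ge0 fM.
apply: inA_le (eq_inA (inAD (inA_expm1m fM M1) fM) _) _ => [t|].
  by rewrite subrK.
by rewrite expr2; nra.
Qed.

Lemma le0_geometric (x C : R) : (forall j, x <= C / 2 ^+ j) -> x <= 0.
Proof.
move=> H; rewrite leNgt; apply/negP => x0.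
have := H (Num.bound (C / x)).
have C0 : 0 <= C by have := H 0%N; rewrite expr0 divr1; lra.
have := archi_boundP (divr_ge0 C0 (ltW x0)); set n := Num.bound _ => Cn.
rewrite ler_pdivlMr ?exprn_gt0// -ler_pdivlMl// mulrC leNgt => /negP; apply.
by apply: lt_trans Cn _; rewrite -natrX ltr_nat ltn_expl.
Qed.

(* Newton's iteration for the logarithm, [l <- l + ((1 + h) exp (- l) - 1)]:
   the increment [r] of a step is followed by [(1 + r) exp (- r) - 1], of norm
   at most [4 |r| ^ 2]. *)
Fixpoint newton h (j : nat) : R -> R[i] :=
  if j is j'.+1 then
    fun t => (1 + newton h j' t) * cexp (- newton h j' t) - 1
  else h.

(** With [q = exp (- r) - 1 + r], of norm at most [2 m^2], the next increment is [(1 + r) q - r^2],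
    of norm at most [4 m^2]. This is at most [m / 2] when [m <= 1 / 8], the origin of that
    threshold. *)
Lemma inA_newton h M j : inA h M -> M <= 1 / 8 -> inA (newton h j) (M / 2 ^+ j).
Proof.
move=> hM M1; elim: j => [|j IH]; first by rewrite expr0 divr1.
have M0 := inA_ge0 hM; have m0 := inA_ge0 IH.
set m := M / 2 ^+ j in IH m0.
have m1 : m <= 1 / 8.
  apply: le_trans M1; rewrite ler_pdivrMr ?exprn_gt0//.
  by rewrite ler_peMr// exprn_ege1// ler1n.
have qI : inA (fun t => cexp (- newton h j t) - 1 - (- newton h j t)) (2 * m ^+ 2).
  by apply: inA_expm1m (inAN IH) _; lra.
apply: inA_le (eq_inA (inAB (inAM (inAD inA1 IH) qI) (inAM IH IH)) _) _ => [t|] /=.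
  by ring.
have -> : M / 2 ^+ j.+1 = m / 2 by rewrite /m exprS; field; rewrite expf_neq0.
rewrite expr2; nra.
Qed.

(** Let [l i] be the sum of the increments from the [i]-th on. Then
    [(1 + newton h i) * cexp (- l i)] does not depend on [i], because a step moves one increment
    from the exponent into the factor. Its limit is 1, so its value at [i = 0] is 1 too. *)
Lemma inA_ln h M : inA h M -> M <= 1 / 8 ->
  exists2 l, inA l (2 * M) & forall t, cexp (l t) = 1 + h t.
Proof.
move=> hM M1; have M0 := inA_ge0 hM.
pose l i t := cusum (fun j => newton h (j + i) t).
have rI j := inA_newton j hM M1.
have geo i : (l1 (fun j => M / 2 ^+ (j + i))%R <= (2 * M / 2 ^+ i)%:E)%E.
  rewrite (_ : (fun j => _) = (fun j => M / 2 ^+ i * 2^-1 ^+ j)); last first.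
    by apply/funext => j; rewrite exprD exprVn; field; rewrite !expf_neq0.
  rewrite l1Z ger0_norm ?divr_ge0 ?exprn_ge0//.
  rewrite (_ : 2 * M / 2 ^+ i = M / 2 ^+ i * (1 - 2^-1)^-1); last first.
    by field; rewrite expf_neq0//=.
  rewrite (EFinM (M / 2 ^+ i)); apply: lee_wpmul2l; first by rewrite lee_fin divr_ge0 ?exprn_ge0.
  by apply: l1_geometric_le; lra.
have lI i : inA (l i) (2 * M / 2 ^+ i) by apply: inA_cusum (geo i) => j; exact: rI.
have lS i t : l i t = newton h i t + l i.+1 t.
  rewrite /l cusum_nat_peel ?add0n.
    by congr (_ + cusum _); apply/funext => j; rewrite addSnnS.
  apply: le_lt_trans (ltry (2 * M / 2 ^+ i)).
  exact: (@inA_cl1 _ _ (fun j => newton h (j + i)) _ _ t (fun j => rI (j + i)%N) (geo i)).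
have const i t : (1 + newton h i t) * cexp (- l i t) = (1 + h t) * cexp (- l 0%N t).
  elim: i => // i <-; rewrite (lS i) opprD cexpD /=; ring.
exists (l 0%N); first by have := lI 0%N; rewrite expr0 divr1.
move=> t; suff H : (1 + h t) * cexp (- l 0%N t) = 1.
  transitivity ((1 + h t) * cexp (- l 0%N t) * cexp (l 0%N t)).
    by rewrite H mul1r.
  by rewrite -mulrA cexpN mulr1.
apply/eqP; rewrite -subr_eq0 -normc_eq0 eq_le normc_ge0 andbT.
(* With [m = M / 2 ^+ j], the tail [l j] has norm at most [2 m], its exponential is within [4 m] of
   1, and the deviation is at most [(1 + m) * 4 m + m <= 9 m]. *)
apply: (@le0_geometric _ (9 * M)) => j; rewrite -(const j t).
have p1 : M / 2 ^+ j <= 1 / 8.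
  apply: le_trans M1; rewrite ler_pdivrMr ?exprn_gt0//.
  by rewrite ler_peMr// exprn_ege1// ler1n.
have p0 : 0 <= M / 2 ^+ j by rewrite divr_ge0 ?exprn_ge0.
have n1 := normc_inA t (rI j).
have := normc_inA t (inA_expm1 (inAN (lI j)) _); rewrite -!mulrA => n2; have {}n2 := n2 ltac:(lra).
have -> : (1 + newton h j t) * cexp (- l j t) - 1 =
  (1 + newton h j t) * (cexp (- l j t) - 1) + newton h j t by ring.
apply: le_trans (normcD _ _) _; rewrite normcM.
have := normcD 1 (newton h j t); rewrite normc1.
move: n1 n2 p0 p1 (normc_ge0 (1 + newton h j t)) (normc_ge0 (cexp (- l j t) - 1)).
move: (M / 2 ^+ j) (normc _) (normc _) (normc _) => m A B D; nra.
Qed.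

End ExpLog.

(** * Spectral exponents: uniqueness and stability *)

Section Spectral.
Local Open Scope complex_scope.
Context {R : realType}.
Implicit Types (z w : R[i]) (a b : R -> R) (f g h : R -> R[i]).

(** Summing over the whole line costs nothing: the term at [v = 0] is 0, and [lam] will vanish off
    the span. *)
Definition spec (gam : R) (lam : R -> R) (t : R) : R[i] :=
  (0 +i* (t * gam)) + cusum (fun v => (lam v)%:C * (eit v t - 1)).

Lemma cl1_realc (a : R -> R) : cl1 (fun v => (a v)%:C) = l1 a.
Proof. by rewrite -[RHS]l1_norm; congr l1; apply/funext => v; rewrite normc_real. Qed.

Lemma specE gam lam t : (l1 lam < +oo)%E ->
  spec gam lam t = (0 +i* (t * gam)) + ft lam t - (usum lam)%:C.
Proof.
move=> sl; rewrite /spec -addrA; congr (_ + _).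
rewrite -cusum_real ftE -cusumB ?cl1_ft ?cl1_realc//.
by congr cusum; apply/funext => v; rewrite mulrBr mulr1.
Qed.

Lemma ft_t0 a : ft a 0 = (usum a)%:C.
Proof. by rewrite !ftE -cusum_real; congr cusum; apply/funext => x; rewrite eit_t0 mulr1. Qed.

Lemma normc_cexpB1 z : normc (cexp z - 1) <= expR (normc z) - 1.
Proof.
rewrite cexpE (cusum_nat_peel (cl1_exp_fin z)) expr0 divr1 addrAC subrr add0r.
apply: normc_cusum; have := l1_exp_le (normc_ge0 z).
rewrite l1_nat_peel expr0 divr1 normr1 EFinB -leeBrDl//.
apply: le_trans; apply: le_l1 => k.
by rewrite normcM normcV normc_nat normcX.
Qed.

Lemma normc_eitB1 (x t : R) : normc (eit x t - 1) <= 4 * `|t * x|.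
Proof.
have [h|h] := lerP (`|t * x|) (1 / 2); last first.
  apply: le_trans (normcB _ _) _; rewrite normc_eit normc1; lra.
rewrite eit_cexp; apply: le_trans (normc_cexpB1 _) _.
have -> : normc (0 +i* (t * x)) = `|t * x| by rewrite /= expr0n add0r sqrtr_sqr.
have := expR_half_le (normr_ge0 (t * x)) h.
move: (normr_ge0 (t * x)) h; move: `|t * x| (expR _) => u v; rewrite expr2; nra.
Qed.

Lemma ft_unif_cont b (e : R) : (l1 b < +oo)%E -> 0 < e ->
  exists2 d : R, 0 < d & forall h t : R, `|h| <= d -> normc (ft b (t + h) - ft b t) <= e.
Proof.
move=> sb e0; have e4 : 0 < e / 4 by lra.
have [s us se] := l1_tail sb e4.
pose B := \sum_(x <- s) `|b x * x|.
have B0 : 0 <= B by apply: sumr_ge0.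
have p : 0 < 8 * (1 + B) by lra.
(* On the finite head the error is at most [4 * |h| * B <= e / 2]. On the tail, of norm at most
   [e / 4], each exponential moves by at most 2. *)
exists (e / (8 * (1 + B))); first by rewrite divr_gt0.
move=> h t hd.
rewrite !ftE -cusumB ?cl1_ft//; apply: normc_cusum.
pose u x := normc ((b x)%:C * eit x (t + h) - (b x)%:C * eit x t).
have uE x : u x = `|b x| * normc (eit x h - 1).
  rewrite /u eitDt (_ : _ - _ = (b x)%:C * (eit x t * (eit x h - 1))); last by ring.
  by rewrite !normcM normc_real normc_eit mul1r.
have u0 x : 0 <= u x by exact: normc_ge0.
rewrite /cl1 -/u (l1_split (mem s)) (_ : e = e / 2 + e / 2); last by lra.
rewrite EFinD; apply: leeD.
  rewrite (@l1_finsupp _ _ s)//; last by move=> x /= /negbTE ->.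
  rewrite lee_fin; apply: (@le_trans _ _ (4 * `|h| * B)).
    rewrite mulr_sumr big_seq [leRHS]big_seq; apply: ler_sum => x xs /=.
    rewrite xs (ger0_norm (u0 x)) uE normrM.
    have := normc_eitB1 x h; rewrite normrM.
    move: (normr_ge0 (b x)) => b0 H; have := ler_wpM2l b0 H; lra.
  move: hd; rewrite ler_pdivlMr// => hd.
  by move: (normr_ge0 h) => h0; nra.
apply: (@le_trans _ _ (2%:E * l1 (fun x => if x \in s then 0 else b x)%R)%E).
  rewrite -[2 in leRHS]ger0_norm// -l1Z; apply: le_l1 => x /=.
  case: ifP => _; first by rewrite mulr0.
  rewrite ger0_norm// uE normrM ger0_norm// mulrC; apply: ler_wpM2r => //.
  by apply: le_trans (normcB _ _) _; rewrite normc_eit normc1.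
apply: (@le_trans _ _ (2%:E * (e / 4)%:E)%E); first exact: lee_wpmul2l.
by rewrite -EFinM lee_fin; lra.
Qed.

(** The modulus forces the real part to be 0. Then the cosine of the imaginary part is 1, and the
    cosine is injective on the interval from 0 to [pi], which contains the interval from 0 to 2. *)
Lemma cexp_eq1_small z : cexp z = 1 -> `|complex.Im z| <= 2 -> z = 0.
Proof.
case: z => x y H y2.
have x0 : x = 0.
  have := normc_cexp (x +i* y); rewrite H normc1 /= -expR0.
  by move/expR_inj.
move: H; rewrite x0 /cexp /= expR0 => /(congr1 (@complex.Re R)).
rewrite ReE /= mul1r mul0r subr0 => cy.
suff -> : y = 0 by [].
apply/eqP; rewrite -normr_eq0; apply/eqP.
apply: (@cos_inj R); rewrite ?in_itv /= ?lexx ?pi_ge0 ?normr_ge0 //=.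
  exact: le_trans y2 (pi_ge2 R).
rewrite cos0; case: (leP 0 y) => h; first by rewrite ger0_norm.
by rewrite ltr0_norm// cosN.
Qed.

(* Both exponents vanish at [0] and are uniformly continuous, so they agree
   along an arithmetic progression of small step. *)
Lemma log_unique b (c Dl : R) : (l1 b < +oo)%E -> c = usum b ->
  (forall t, cexp ((0 +i* (t * Dl)) + ft b t - c%:C) = 1) ->
  forall t, (0 +i* (t * Dl)) + ft b t - c%:C = 0.
Proof.
move=> sb cb H t; set D := fun t => (0 +i* (t * Dl)) + ft b t - c%:C.
rewrite -/(D t).
have D0 : D 0 = 0.
  by rewrite /D mul0r ft_t0 cb -[0 +i* 0]/(0 : R[i]) add0r subrr.
have [d d0 dP] := @ft_unif_cont b 1 sb ltr01.
(* Over a step of this length the linear term and [ft b] each move by at most 1, which together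
   meets the bound 2 of [cexp_eq1_small]. *)
pose d' := Num.min d (1 / (1 + `|Dl|)).
have p : 0 < 1 + `|Dl| by rewrite ltr_wpDr.
have d'0 : 0 < d' by rewrite lt_min d0 divr_gt0.
have step (s h : R) : `|h| <= d' -> D (s + h) = D s.
  rewrite le_min => /andP[hd hD].
  apply/eqP; rewrite -subr_eq0; apply/eqP/cexp_eq1_small.
    rewrite cexpD H mul1r; have := cexpN (D s); rewrite H.
    by rewrite mulr1.
  have -> : D (s + h) - D s = (0 +i* (h * Dl)) + (ft b (s + h) - ft b s).
    have -> : 0 +i* (h * Dl) = (0 +i* ((s + h) * Dl)) - (0 +i* (s * Dl)).
      by apply: complexP => /=; rewrite ?subrr// -mulrBl addrAC subrr add0r.
    by rewrite /D; ring.
  rewrite ImD /=; apply: le_trans (ler_normD _ _) _.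
  apply: (@le_trans _ _ (1 + 1)); last by lra.
  apply: lerD; last exact: le_trans (normc_Im _) (dP _ _ hd).
  rewrite normrM; move: hD; rewrite ler_pdivlMr// => hD.
  by apply: le_trans hD; rewrite mulrDr mulr1 lerDr.
pose n := Num.bound (`|t| / d').
have n0 : 0 < n%:R :> R.
  apply: le_lt_trans (archi_boundP _); last by rewrite divr_ge0// ltW.
  by rewrite divr_ge0// ltW.
have th : `|t / n%:R| <= d'.
  rewrite normrM normfV (ger0_norm (ltW n0)) ler_pdivrMr// mulrC -ler_pdivrMr//.
  by apply/ltW/archi_boundP; rewrite divr_ge0// ltW.
have K k : D (k%:R * (t / n%:R)) = 0.
  elim: k => [|k IH]; first by rewrite mul0r.
  by rewrite -natr1 mulrDl mul1r step.
by have := K n; rewrite mulrCA mulfV ?mulr1// gt_eqF.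
Qed.

Lemma bounded_linear0 (x B : R) : (forall t, `|t * x| <= B) -> x = 0.
Proof.
move=> H; apply/eqP/negPn/negP => x0; have := H ((`|B| + 1) / x).
by rewrite divfK// ger0_norm ?addr_ge0//; have := ler_norm B; lra.
Qed.

(** By [log_unique] the difference of the exponents equals [l] exactly. The linear part is then
    bounded, so the slopes agree; what remains says that a trigonometric sum is constant, so its
    coefficients are concentrated at 0. Away from 0 the difference [lam1 - lam2] is therefore the
    coefficient family of [l], and at 0 it vanishes. *)
Lemma spec_unique gam1 gam2 lam1 lam2 l m :
  (l1 lam1 < +oo)%E -> (l1 lam2 < +oo)%E -> lam1 0 = 0 -> lam2 0 = 0 ->
  inA l m -> (forall t, cexp (spec gam1 lam1 t - spec gam2 lam2 t) = cexp (l t)) ->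
  gam1 = gam2 /\ (l1 (fun x => lam1 x - lam2 x)%R <= m%:E)%E.
Proof.
move=> s1 s2 z1 z2 [a am la] H.
have sa : (l1 a < +oo)%E by apply: le_lt_trans am (ltry _).
pose lam x := lam1 x - lam2 x.
have slam : (l1 lam < +oo)%E by apply: l1D_fin; rewrite ?l1N.
pose b x := lam x - a x.
have sb : (l1 b < +oo)%E by apply: l1D_fin; rewrite ?l1N.
pose c := usum lam.
have bE t : ft b t = ft lam1 t - ft lam2 t - l t.
  rewrite (ftB t slam sa) (ftB t s1 s2) -la //.
have sbE : usum b = usum lam - usum a by exact: usumB.
have D t : spec gam1 lam1 t - spec gam2 lam2 t - l t =
    (0 +i* (t * (gam1 - gam2))) + ft b t - c%:C.
  rewrite !specE// bE /c (usumB s1 s2) rmorphB.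
  have -> : 0 +i* (t * (gam1 - gam2)) = (0 +i* (t * gam1)) - (0 +i* (t * gam2)).
    by apply: complexP; rewrite /= ?subrr// mulrBr.
  by ring.
have H1 t : cexp ((0 +i* (t * (gam1 - gam2))) + ft b t - c%:C) = 1.
  by rewrite -D cexpD H mulrC cexpN.
(* At [t = 0] both exponents vanish, so [exp (l 0) = 1]; as [l 0 = usum a] is real, it is 0. This
   supplies the normalisation [c = usum b]. *)
have a0 : usum a = 0.
  have := H1 0; rewrite mul0r ft_t0 sbE -/c (_ : _ - c%:C = (- usum a)%:C); last first.
    by apply: complexP => /=; ring.
  move=> /(congr1 (@normc R)); rewrite normc_cexp normc1 /= -expR0.
  by move/expR_inj/eqP; rewrite oppr_eq0 => /eqP.
have cb : c = usum b by rewrite sbE a0 subr0.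
have H2 := log_unique sb cb H1.
have g0 : gam1 - gam2 = 0.
  apply: (@bounded_linear0 _ (fine (l1 b))) => t.
  have := congr1 (@complex.Im R) (H2 t).
  rewrite !ImD (_ : complex.Im (0 +i* _) = t * (gam1 - gam2))// (_ : complex.Im (- _) = 0).
    2: by rewrite /= oppr0.
  rewrite addr0 => /eqP; rewrite addr_eq0 => /eqP ->; rewrite normrN; apply: le_trans (normc_Im _) _.
  by apply: normc_ft; rewrite fineK// l1_fin_num.
split; first by apply/eqP; rewrite -subr_eq0 g0.
have bc t : ft b t = c%:C.
  by apply/eqP; rewrite -subr_eq0 -(H2 t) g0 mulr0 -[0 +i* 0]/(0 : R[i]) add0r.
have [d dc dE] := inA_real c.
have bd : b = d.
  apply: ft_inj => // [|t]; first exact: le_lt_trans dc (ltry _).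
  by rewrite bc -dE.
have dd : d = (fun x => if x == 0 then c else 0).
  have sd : (l1 (fun x : R => if x == 0 then c else 0)%R < +oo)%E.
    by rewrite (@l1_single _ _ 0) ?ltry// => x /negbTE ->.
  apply: ft_inj => // [|t]; first exact: le_lt_trans dc (ltry _).
  rewrite -dE !ftE (@cusum_single _ _ 0) ?eqxx ?eit0 ?mulr1// => x /negbTE ->.
  by rewrite mul0r.
apply: le_trans am; apply: le_l1 => x.
have [->|x0] := eqVneq x 0; first by rewrite z1 z2 subrr normr0.
have : b x = 0 by rewrite bd dd (negbTE x0).
by rewrite /b /lam => /eqP; rewrite subr_eq0 => /eqP ->.
Qed.

Lemma normc_spec gam lam t (C : R) : (l1 lam <= C%:E)%E ->
  expR (- (2 * C)) <= normc (cexp (spec gam lam t)).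
Proof.
move=> lC; have sl : (l1 lam < +oo)%E by apply: le_lt_trans lC (ltry _).
rewrite normc_cexp ler_expR specE//.
rewrite (_ : complex.Re _ = complex.Re (ft lam t) - usum lam); last by rewrite !ReD /= add0r.
have := le_trans (normc_Re _) (normc_ft t lC).
have := ler_norm_usum lC; rewrite !ler_norml; lra.
Qed.

(** Exponents are given for the [ft (a n)], while the limit enters through its inverse [g]. It
    cancels in the quotient of [ft (a n) * g] by [ft (a m) * g], which is both the exponential of a
    difference of exponents and that of a difference of small logarithms. *)
Lemma spec_cauchy (a : nat -> R -> R) b (gam : nat -> R) (lam : nat -> R -> R) mu :
  (forall n t, ft (a n) t = cexp (spec (gam n) (lam n) t)) ->
  (forall n, l1 (lam n) < +oo)%E -> (forall n, lam n 0 = 0) ->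
  (forall n, l1 (a n) < +oo)%E -> (l1 b <= 1%:E)%E -> 0 < mu ->
  (forall t, mu <= normc (ft b t)) ->
  (forall e, 0 < e -> exists N, forall n, (N <= n)%N ->
    (l1 (fun x => a n x - b x)%R <= e%:E)%E) ->
  forall e, 0 < e -> exists N, forall n m, (N <= n)%N -> (N <= m)%N ->
    gam n = gam m /\ (l1 (fun x => lam n x - lam m x)%R <= e%:E)%E.
Proof.
move=> aE sl l0 sa b1 mu0 bmu ab e e0.
have sb : (l1 b < +oo)%E by apply: le_lt_trans b1 (ltry _).
have bA : inA (ft b) 1 by exists b.
have [|g [M [gM gE]]] := wiener bA mu0.
  by move=> t; rewrite bmu normc_ft.
have M0 := inA_ge0 gM.
(* Multiplication by [g] costs a factor [M]. The bound [1 / 8] is the domain of [inA_ln]; [e / 4] is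
   doubled there and doubled again by subtracting two logarithms. *)
pose eta := Num.min (1 / 8) (e / 4) / (1 + M).
have p : 0 < 1 + M by lra.
have mp : 0 < Num.min (1 / 8) (e / 4) by rewrite lt_min; lra.
have eta0 : 0 < eta by rewrite divr_gt0.
have [N NP] := ab eta eta0.
have etaM : eta * M <= Num.min (1 / 8) (e / 4).
  rewrite /eta mulrAC ler_pdivrMr//; apply: ler_wpM2l; [exact: ltW|by lra].
have eqC (u v w : R[i]) : v * w = 1 -> 1 + (u - v) * w = u * w.
  by move=> H; rewrite mulrBl H addrC subrK.
have L n : (N <= n)%N -> exists2 l, inA l (2 * Num.min (1 / 8) (e / 4)) &
    forall t, cexp (l t) = ft (a n) t * g t.
  move=> /NP h; have hI : inA (fun t => (ft (a n) t - ft b t) * g t) (eta * M).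
    apply: inAM gM; exists (fun x => a n x - b x) => // t.
    by rewrite ftB.
  have [|l lI lE] := inA_ln (inA_le hI etaM); first by rewrite ge_min lexx.
  by exists l => // t; rewrite lE (eqC _ _ _ (gE t)).
exists N => n m nN mN.
have [ln lnI lnE] := L n nN; have [lm lmI lmE] := L m mN.
apply: spec_unique (sl n) (sl m) (l0 n) (l0 m) (inA_le (inAB lnI lmI) _) _.
  have : Num.min (1 / 8) (e / 4) <= e / 4 by rewrite ge_min lexx orbT.
  by lra.
move=> t; rewrite (cexpD (spec _ _ _)) (cexpD (ln t)).
have nz k : cexp (spec (gam k) (lam k) t) != 0 by rewrite -normc_eq0 normc_cexp gt_eqF// expR_gt0.
have inv z : cexp (- z) = (cexp z)^-1 :> R[i].
  have h : cexp z != 0 by rewrite -normc_eq0 normc_cexp gt_eqF// expR_gt0.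
  by apply: (mulIf h); rewrite cexpN mulVf.
rewrite !inv lnE lmE !aE.
have g0 : g t != 0 by apply/eqP => g0; have := gE t; rewrite g0 mulr0 => /esym/eqP; rewrite oner_eq0.
by field; rewrite nz g0.
Qed.

(** With equal [gam] the exponents differ by [ft d - usum d], of norm at most [2 e]. Writing the
    difference of the two functions as [ft a'] times an exponential minus 1 doubles this to [4 e],
    for which [2 e <= 1 / 2] is required. *)
Lemma spec_close a a' (gam : R) (lam lam' : R -> R) (e : R) :
  (forall t, ft a t = cexp (spec gam lam t)) ->
  (forall t, ft a' t = cexp (spec gam lam' t)) ->
  (l1 a <= 1%:E)%E -> (l1 a' <= 1%:E)%E -> (l1 lam < +oo)%E -> (l1 lam' < +oo)%E ->
  (l1 (fun x => lam x - lam' x)%R <= e%:E)%E -> e <= 1 / 4 ->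
  (l1 (fun x => a x - a' x)%R <= (4 * e)%:E)%E.
Proof.
move=> aE aE' a1 a1' sl sl' le e4.
have sa : (l1 a < +oo)%E by apply: le_lt_trans a1 (ltry _).
have sa' : (l1 a' < +oo)%E by apply: le_lt_trans a1' (ltry _).
pose d x := lam x - lam' x.
have WI : inA (fun t => ft d t - (usum d)%:C) (e + e).
  apply: inAB; first by exists d.
  by apply: inA_le (inA_real _) _; apply: ler_norm_usum.
apply: inA_ft; first by apply: l1D_fin; rewrite ?l1N.
have a'I : inA (ft a') 1 by exists a'.
have e1 : e + e <= 1 / 2 by lra.
have I := inAM a'I (inA_expm1 WI e1).
apply: inA_le (eq_inA I _) _ => [t|]; last by lra.
rewrite (ftB t sa sa') mulrBr mulr1 aE aE' -cexpD; congr (cexp _ - _).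
rewrite !specE// (ftB t sl sl') (usumB sl sl') rmorphB; ring.
Qed.

(** The Cauchy estimate passes to the pointwise limit on each finite partial sum. Pointwise
    convergence is recorded because it preserves the sign of masses. *)
Lemma l1_complete (a : nat -> R -> R) :
  (forall e, 0 < e -> exists N, forall n m, (N <= n)%N -> (N <= m)%N ->
    (l1 (fun x => a n x - a m x)%R <= e%:E)%E) ->
  exists b, (forall x, a ^~ x @ \oo --> b x) /\
    forall e, 0 < e -> exists N, forall n, (N <= n)%N ->
      (l1 (fun x => a n x - b x)%R <= e%:E)%E.
Proof.
move=> H.
have cv x : cvgn (a ^~ x).
  apply/cauchy_cvgP/cauchy_exP => e e0.
  have [N NP] := H (e / 2) (divr_gt0 e0 (ltr0Sn _ _)).
  exists (a N x), N => // n /= Nn; rewrite -ball_normE /=.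
  apply: (@le_lt_trans _ _ (e / 2)); last by rewrite gtr_pMr// invf_lt1// ltr1n.
  rewrite -lee_fin; apply: le_trans (NP N n (leqnn N) Nn).
  exact: (le_norm_l1 (fun x => a N x - a n x)).
pose b x := limn (a ^~ x).
have ab x : a ^~ x @ \oo --> b x by exact: cv.
exists b; split => // e e0; have [N NP] := H e e0; exists N => n Nn.
apply: l1_le_seq => s us.
have lim : (fun m => \sum_(x <- s) `|a n x - a m x|) @ \oo --> \sum_(x <- s) `|a n x - b x|.
  elim: s {us} => [|x s IH].
    rewrite big_nil (_ : (fun _ => _) = cst 0); first exact: cvg_cst.
    by apply/funext => m; rewrite big_nil.
  rewrite big_cons (_ : (fun _ => _) = (fun m => `|a n x - a m x| + \sum_(x <- s) `|a n x - a m x|)).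
    by apply: cvgD IH; apply: cvg_norm; apply: cvgB (ab x); exact: cvg_cst.
  by apply/funext => m; rewrite big_cons.
apply: (cvgr_to_le lim); exists N => // m /= Nm.
rewrite -lee_fin; apply: le_trans (NP n m Nn Nm).
exact: (l1_sub_seq (fun x => a n x - a m x)).
Qed.

End Spectral.

(** * Extraction of subsequences *)

Section Subsequences.

Definition unbounded (S : set nat) := forall N, exists2 n, (N <= n)%N & S n.

(** A subsequence is encoded by its infinite set of indices, so that successive refinements are
    inclusions instead of compositions. Total boundedness takes the form of a relation that can be
    made to hold between all the indices kept. *)
Definition thinnable (r : nat -> nat -> Prop) :=
  forall S, unbounded S -> exists S', [/\ unbounded S', S' `<=` S &
    forall m n, S' m -> S' n -> r m n].

Lemma thinnable_mono (r r' : nat -> nat -> Prop) :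
  (forall m n, r m n -> r' m n) -> thinnable r -> thinnable r'.
Proof.
move=> rr' H S /H[S' [uS' S'S rS']]; exists S'; split => // m n Sm Sn.
exact/rr'/rS'.
Qed.

Lemma thinnable_and (r r' : nat -> nat -> Prop) :
  thinnable r -> thinnable r' -> thinnable (fun m n => r m n /\ r' m n).
Proof.
move=> H H' S /H[S1 [/H'[S2 [u2 s21 r2]] s1 r1]]; exists S2; split => //.
  exact: subset_trans s21 s1.
by move=> m n Sm Sn; split; [apply: r1; exact: s21|exact: r2].
Qed.

Lemma thinnable_forall (r : nat -> nat -> nat -> Prop) N :
  (forall k, thinnable (r k)) ->
  thinnable (fun m n => forall k, (k < N)%N -> r k m n).
Proof.
move=> H; elim: N => [|N IH].
  by move=> S uS; exists S; split.
apply: thinnable_mono (thinnable_and IH (H N)) => m n [h hN] k.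
by rewrite ltnS leq_eqVlt => /predU1P[->|/h].
Qed.

(** Either the last colour occurs at unboundedly many indices of [S], or it disappears from some
    index on and one colour fewer remains. *)
Lemma pigeonhole_color (c : nat -> nat) B :
  (forall n, (c n < B)%N) -> thinnable (fun m n => c m = c n).
Proof.
move=> cB S uS.
have {cB} : forall n, S n -> (c n < B)%N by [].
elim: B S uS => [|B IH] S uS cB.
  by have [n _ /cB] := uS 0%N; rewrite ltn0.
have [uB|] := pselect (unbounded (S `&` [set n | c n = B])).
  exists (S `&` [set n | c n = B]); split; [exact: uB|by move=> n []|].
  by move=> m n [_ ->] [_ ->].
move=> /existsNP[N NP].
have [|n [Sn /= nN]|S' [uS' S'S rS']] := IH (S `&` [set n | (N <= n)%N]).
- move=> M; have [n + Sn] := uS (maxn M N); rewrite geq_max => /andP[Mn Nn].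
  by exists n.
- have := cB n Sn; rewrite ltnS leq_eqVlt => /predU1P[cn|//].
  by exfalso; apply: NP; exists n.
- exists S'; split => //; by move=> n /S'S[].
Qed.

Lemma thinnable_finite (T : choiceType) (x : nat -> T) :
  finite_set (range x) -> thinnable (fun m n => x m = x n).
Proof.
move=> /finite_seqP[s sE].
have xs n : x n \in s.
  by have : [set` s] (x n) by rewrite -sE; exists n.
have : thinnable (fun m n => index (x m) s = index (x n) s).
  by apply: (@pigeonhole_color _ (size s)) => n; rewrite index_mem.
apply: thinnable_mono => m n /(congr1 (nth (x 0%N) s)).
by rewrite !nth_index.
Qed.

(** The colour of [n] is the cell of width [d] containing [x n]; boundedness leaves finitely many
    cells. *)
Lemma thinnable_real (R : realType) (x : nat -> R) (C d : R) : 0 < d ->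
  (forall n, `|x n| <= C) -> thinnable (fun m n => `|x m - x n| <= d).
Proof.
move=> d0 xC; pose y n := (x n + C) / d.
have y0 n : 0 <= y n.
  apply: divr_ge0; last exact: ltW.
  by have := xC n; rewrite ler_norml; lra.
have : thinnable (fun m n => Num.truncn (y m) = Num.truncn (y n)).
  apply: (@pigeonhole_color _ (Num.truncn (2 * C / d)).+1) => n; rewrite ltnS.
  apply: le_truncn; rewrite ler_pM2r ?invr_gt0//.
  by have := xC n; rewrite ler_norml; lra.
apply: thinnable_mono => m n H.
have /andP[m1 m2] := truncn_itv (y0 m); have /andP[n1 n2] := truncn_itv (y0 n).
rewrite H in m1 m2; rewrite -addn1 natrD in m2 n2.
have xE k : x k = y k * d - C by rewrite /y divfK ?gt_eqF// addrK.
have -> : x m - x n = (y m - y n) * d by rewrite !xE; ring.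
rewrite normrM (gtr0_norm d0); apply: ler_piMl; first exact: ltW.
by rewrite ler_norml; lra.
Qed.

Lemma diagonal_subsequence (r : nat -> nat -> nat -> Prop) :
  (forall j, thinnable (r j)) ->
  exists2 psi : nat -> nat, increasing_seq psi &
    forall j m n, (j <= m)%N -> (j <= n)%N -> r j (psi m) (psi n).
Proof.
move=> H.
pose U := {S : set nat | unbounded S}.
have /choice[next nextP] : forall p : nat * U, exists S' : U,
    sval S' `<=` sval p.2 /\
    forall m n, sval S' m -> sval S' n -> r p.1 m n.
  move=> [j [S uS]]; have [S' [uS' S'S rS']] := H j S uS.
  by exists (exist _ S' uS').
have uT : unbounded setT by move=> N; exists N.
pose T := fix T j : U := if j is j'.+1 then next (j', T j') else exist _ setT uT.
have Tmono i j : (i <= j)%N -> sval (T j) `<=` sval (T i).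
  elim: j => [|j IH]; first by rewrite leqn0 => /eqP ->.
  rewrite leq_eqVlt => /predU1P[->//|]; rewrite ltnS => /IH h.
  by apply: subset_trans h; have [] := nextP (j, T j).
have rT j m n : sval (T j.+1) m -> sval (T j.+1) n -> r j m n.
  by have [_] := nextP (j, T j); exact.
have /choice[pick pickP] : forall p : nat * nat, exists n,
    (p.2 <= n)%N /\ sval (T p.1) n.
  by move=> [j N]; have [n Nn Sn] := svalP (T j) N; exists n.
(* The set [T 0] is all of [nat] and [T j.+1] has been thinned for [r j]; hence [psi j] is taken in
   [T j.+1], above the previous choice. *)
pose psi := fix psi j := if j is j'.+1 then pick (j.+1, (psi j').+1) else pick (1%N, 0%N).
have psiT j : sval (T j.+1) (psi j).
  case: j => [|j] /=; first by have [] := pickP (1%N, 0%N).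
  by have [] := pickP (j.+2, (psi j).+1).
exists psi.
  by apply/increasing_seqP => n; have [] := pickP (n.+2, (psi n).+1).
move=> j m n jm jn; apply: rT.
- by apply: Tmono (psiT m); rewrite ltnS.
- by apply: Tmono (psiT n); rewrite ltnS.
Qed.

(** Turns the failure of a condition into one subsequence whose [k]-th term is bad at level [k]. In
    a further subsequence the levels still tend to infinity. *)
Lemma bad_subsequence (Q : nat -> nat -> Prop) :
  (forall k N, exists2 n, (N <= n)%N & Q k n) ->
  exists2 phi : nat -> nat, increasing_seq phi & forall k, Q k (phi k).
Proof.
move=> H.
have /choice[pick pickP] : forall p : nat * nat, exists n, (p.2 <= n)%N /\ Q p.1 n.
  by move=> [k N]; have [n] := H k N; exists n.
pose phi := fix phi j := if j is j'.+1 then pick (j, (phi j').+1) else pick (0%N, 0%N).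
exists phi; last first.
  case=> [|k] /=; first by have [] := pickP (0%N, 0%N).
  by have [] := pickP (k.+1, (phi k).+1).
by apply/increasing_seqP => n; have [] := pickP (n.+1, (phi n).+1).
Qed.

Lemma increasing_seq_ge (phi : nat -> nat) n : increasing_seq phi -> (n <= phi n)%N.
Proof.
move=> /increasing_seqP H; elim: n => // n IH.
exact: leq_ltn_trans IH (H n).
Qed.

End Subsequences.

(** * Discrete distribution functions *)

Section Discrete.
Local Open Scope complex_scope.
Context {R : realType}.
Implicit Types (F G : distr_fun R) (a b : R -> R).

Lemma series_l1 (p : nat -> R) (s : R) : (forall k, 0 <= p k) ->
  series p @ \oo --> s -> l1 p = s%:E.
Proof.
move=> p0 ps.
have nd : nondecreasing_seq (series p) by apply: nondecreasing_series => k _ _.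
have ls : (l1 p <= s%:E)%E.
  apply: l1_nat_le => n.
  have := nondecreasing_cvgn_le nd (cvgP _ ps) n; rewrite (cvg_lim (@Rhausdorff R) ps).
  rewrite /series /= big_mkord; apply: le_trans.
  by apply: ler_sum => k _; rewrite ger0_norm.
have lo : (l1 p < +oo)%E by apply: le_lt_trans ls (ltry _).
rewrite -[LHS]fineK ?l1_fin_num//; congr _%:E; rewrite -usum_ge0E//.
exact: (cvg_unique (@Rhausdorff R) (usum_nat_cvg lo) ps).
Qed.

Lemma normr_bool_le1 (b : bool) : `|b%:R : R| <= 1.
Proof. by case: b; rewrite /= ?normr1 ?normr0. Qed.

Lemma normr_boolB_le1 (b c : bool) : `|b%:R - c%:R : R| <= 1.
Proof.
by case: b; case: c; rewrite /= ?subrr ?subr0 ?sub0r ?normrN ?normr1 ?normr0 ?ler01.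
Qed.

(** * Integration against a discrete law *)

Section Repr.
Context (F : distr_fun R) (x p : nat -> R) (Fxp : discrete_repr F x p).

Let p0 k : 0 <= p k. Proof. by have [] := Fxp. Qed.

Lemma repr_l1 : l1 p = 1%:E.
Proof. by have [_ _ p1 _] := Fxp; exact: series_l1. Qed.

Lemma repr_l1_bounded (g : nat -> R) : (forall k, `|g k| <= 1) ->
  (l1 (fun k => p k * g k)%R < +oo)%E.
Proof.
move=> g1; apply: (@le_lt_trans _ _ (l1 p)); last by rewrite repr_l1 ltry.
by apply: le_l1 => k; rewrite normrM ler_piMr.
Qed.

Lemma repr_cdf y : F y = usum (fun k => p k * (x k <= y)%R%:R) :> R.
Proof.
have [_ _ _ Fy] := Fxp.
apply: (cvg_unique (@Rhausdorff R) (Fy y)); apply: usum_nat_cvg.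
by apply: repr_l1_bounded => k; exact: normr_bool_le1.
Qed.

Let mu_ k : {measure set (measurableTypeR R) -> \bar R} :=
  mscale (NngNum (p0 k)) (@dirac _ (measurableTypeR R) (x k) R).
Let mu : {measure set (measurableTypeR R) -> \bar R} := mseries mu_ 0.

Let ind_le1 (A : set R) k : `|\1_A (x k) : R| <= 1.
Proof. by rewrite indicE; exact: normr_bool_le1. Qed.

Let muE A : mu A = (usum (fun k => p k * \1_A (x k)))%:E.
Proof.
have lo := repr_l1_bounded (ind_le1 A).
have ge0 k : 0 <= p k * \1_A (x k) by rewrite mulr_ge0// indicE.
rewrite (usum_ge0E lo ge0) fineK ?l1_fin_num// l1E.
rewrite /mu /= /mseries nneseries_esumT//.
apply: eq_esum => k _.
by rewrite (ger0_norm (ge0 k)) /mu_ /= /mscale /= diracE indicE EFinM.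
Qed.

(** Both measures agree on the intervals open on the left and closed on the right, where the
    increment of [F] adds the weights of the atoms inside; these intervals determine the measure. *)
Lemma lebesgue_stieltjes_repr A : measurable A ->
  lebesgue_stieltjes_measure F A = mu A.
Proof.
apply: lebesgue_stieltjes_measure_unique => X /ocitvP[->|[[u v] /= uv ->]].
  by rewrite !measure0.
rewrite /lebesgue_stieltjes_measure /measure_extension measurable_mu_extE/=; last exact: is_ocitv.
rewrite wlength_itv_bnd; last exact: ltW.
have lo w := repr_l1_bounded (g := fun k => (x k <= w)%R%:R).
have lo1 w : (l1 (fun k => p k * (x k <= w)%R%:R)%R < +oo)%E.
  by apply: lo => k; exact: normr_bool_le1.
rewrite [RHS](muE _) !repr_cdf -usumB//; congr (_%:E); congr usum; apply/funext => k.
rewrite -mulrBr indicE; congr (_ * _); rewrite mem_setE in_itv /=.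
have [xu|xu] := leP (x k) u; last by rewrite subr0.
by rewrite (le_trans xu (ltW uv)) subrr.
Qed.

Lemma repr_integral (g : R -> R) : measurable_fun setT g ->
  (forall y, `|g y| <= 1) ->
  (\int[lebesgue_stieltjes_measure F]_(y in setT) g y)%R =
  usum (fun k => p k * g (x k)).
Proof.
move=> mg g1; rewrite /Rintegral.
rewrite (eq_measure_integral mu); last by move=> A mA _; exact: lebesgue_stieltjes_repr.
have H (h : R -> R) : measurable_fun setT h -> (forall y, 0 <= h y) ->
    (\int[mu]_(y in setT) (h y)%:E)%E = l1 (fun k => p k * h (x k)).
  move=> mh h0.
  rewrite ge0_integral_measure_series; [|by []|by move=> y _; rewrite lee_fin|exact/measurable_EFinP].
  rewrite nneseries_esumT; last by move=> k; apply: integral_ge0 => y _; rewrite lee_fin.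
  rewrite l1E; apply: eq_esum => k _.
  rewrite ge0_integral_mscale; [|by []|exact/measurable_EFinP|by move=> y _; rewrite lee_fin].
  rewrite integral_dirac; [|by []|exact/measurable_EFinP].
  by rewrite diracE mem_set// mul1e /= -EFinM ger0_norm// mulr_ge0.
pose q y := Num.max (g y) 0; pose n y := Num.max (- g y) 0.
have qn y : [/\ 0 <= q y, 0 <= n y, `|q y| <= 1, `|n y| <= 1 & g y = q y - n y].
  have := g1 y; rewrite ler_norml /q /n /Num.max => /andP[h1 h2].
  split; rewrite ?ler_norml; case: (ltrP (g y) 0) => h; case: (ltrP (- g y) 0) => h'; lra.
have mq : measurable_fun setT q by apply: measurable_maxr.
have mn : measurable_fun setT n by apply: measurable_maxr => //; exact: measurable_funN.
have lq : (l1 (fun k => p k * q (x k))%R < +oo)%E.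
  by apply: repr_l1_bounded => k; have [] := qn (x k).
have ln : (l1 (fun k => p k * n (x k))%R < +oo)%E.
  by apply: repr_l1_bounded => k; have [] := qn (x k).
rewrite integralE.
have -> : (fun y => (g y)%:E)^\+%E = (fun y => (q y)%:E).
  by apply/funext => y; rewrite funeposE EFin_max.
have -> : (fun y => (g y)%:E)^\-%E = (fun y => (n y)%:E).
  by apply/funext => y; rewrite funenegE EFin_max EFinN.
rewrite (H q mq); last by move=> y; have [] := qn y.
rewrite (H n mn); last by move=> y; have [] := qn y.
rewrite fineB ?l1_fin_num// -usum_sub//.
- by congr usum; apply/funext => k; have [_ _ _ _ ->] := qn (x k); rewrite mulrBr.
- by move=> k; have [? _ _ _ _] := qn (x k); rewrite mulr_ge0.
- by move=> k; have [_ ? _ _ _] := qn (x k); rewrite mulr_ge0.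
Qed.

End Repr.

(** The weights as a function on the line: unlike the pair of sequences, this is determined by the
    distribution function. *)
Definition mass_of (x p : nat -> R) (y : R) : R :=
  usum (fun k => p k * (x k == y)%:R).

Definition is_mass F a : Prop :=
  [/\ forall x, 0 <= a x, l1 a = 1%:E &
      forall y, F y = usum (fun x => a x * (x <= y)%R%:R) :> R].

Section Mass.
Context (F : distr_fun R) (x p : nat -> R) (Fxp : discrete_repr F x p).

Lemma mass_of_ge0 y : 0 <= mass_of x p y.
Proof.
have [_ p0 _ _] := Fxp.
rewrite -(usum0 nat); apply: ler_usum.
- by apply: le_lt_trans (ltry 0); rewrite l1E esum1// => k _; rewrite normr0.
- by apply: (repr_l1_bounded Fxp) => k; exact: normr_bool_le1.
- by move=> k; rewrite mulr_ge0.
Qed.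

(** Fubini for the array [p k * g y] restricted to [x k = y], each of whose rows has a single
    entry. *)
Lemma mass_of_usum (g : R -> R) : (forall y, `|g y| <= 1) ->
  (l1 (fun y => mass_of x p y * g y)%R < +oo)%E /\
  usum (fun y => mass_of x p y * g y) = usum (fun k => p k * g (x k)).
Proof.
move=> g1; pose f k y := p k * g y * (x k == y)%:R.
have f0 k y : y != x k -> f k y = 0.
  by move=> yx; rewrite /f eq_sym (negbTE yx) mulr0.
have lf k : l1 (f k) = `|p k * g (x k)|%:E.
  by rewrite (l1_single (f0 k)) /f eqxx mulr1.
have sf : (\esum_(k in setT) l1 (f k) < +oo)%E.
  rewrite (_ : (fun k => l1 (f k)) = (fun k => `|p k * g (x k)|%:E)); last exact/funext.
  by rewrite -(@l1E _ _ (fun k => p k * g (x k))); apply: (repr_l1_bounded Fxp).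
have massE y : mass_of x p y * g y = usum (fun k => f k y).
  rewrite mulrC -usumZ; first by congr usum; apply/funext => k; rewrite /f; ring.
  by apply: (repr_l1_bounded Fxp) => k; exact: normr_bool_le1.
have -> : (fun y => mass_of x p y * g y) = (fun y => usum (fun k => f k y)) by exact/funext.
split.
  by rewrite l1_swap in sf; exact: (@l1_usum_fin _ _ _ (fun y k => f k y)).
rewrite -usum_swap//; congr usum; apply/funext => k.
by rewrite (usum_single (f0 k)) /f eqxx mulr1.
Qed.

Lemma mass_of_is_mass : is_mass F (mass_of x p).
Proof.
split; first exact: mass_of_ge0.
- have [|s sE] := @mass_of_usum (fun=> 1); first by move=> _; rewrite normr1.
  have mulr1E (T : choiceType) (h : T -> R) : (fun y => h y * 1) = h.
    by apply/funext => y; rewrite mulr1.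
  rewrite !mulr1E in s sE; rewrite -[LHS]fineK ?l1_fin_num// -usum_ge0E//; last exact: mass_of_ge0.
  have [_ p0 _ _] := Fxp.
  have pl : (l1 p < +oo)%E by rewrite (repr_l1 Fxp) ltry.
  by rewrite sE usum_ge0E// fineK ?l1_fin_num// (repr_l1 Fxp).
- move=> y; rewrite (repr_cdf Fxp).
  by have [|_ ->] := @mass_of_usum (fun z => (z <= y)%R%:R) => // z; exact: normr_bool_le1.
Qed.

Lemma char_fun_mass_of t : char_fun F t = ft (mass_of x p) t.
Proof.
have c1 y : `|cos (t * y)| <= 1 by rewrite ler_norml cos_geN1 cos_le1.
have s1 y : `|sin (t * y)| <= 1 by rewrite ler_norml sin_geN1 sin_le1.
have mt : measurable_fun setT (fun y : R => t * y) by exact: measurable_funM.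
rewrite /char_fun /cintegral ftE; apply: complexP => /=.
  rewrite (_ : (fun y => _) = (fun y => cos (t * y))); last first.
    by apply/funext => y; rewrite expR0 mul1r mul0r subr0.
  rewrite (repr_integral Fxp); [|exact: (measurableT_comp (continuous_measurable_fun (@continuous_cos R)) mt)|exact: c1].
  rewrite -(proj2 (mass_of_usum c1)); congr usum; apply/funext => y.
  by rewrite eitE /= mul0r subr0.
rewrite (_ : (fun y => _) = (fun y => sin (t * y))); last first.
  by apply/funext => y; rewrite expR0 mul1r mul0r addr0.
rewrite (repr_integral Fxp); [|exact: (measurableT_comp (continuous_measurable_fun (@continuous_sin R)) mt)|exact: s1].
rewrite -(proj2 (mass_of_usum s1)); congr usum; apply/funext => y.
by rewrite eitE /= mul0r addr0.
Qed.

End Mass.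

(** * Distribution functions with prescribed masses *)

Lemma usum_vanish (d : R -> R) (s : seq R) (e : R) (g : R -> R) :
  (l1 (fun x => if x \in s then 0 else d x)%R <= e%:E)%E ->
  (forall x, x \in s -> g x = 0) -> (forall x, `|g x| <= 1) ->
  `|usum (fun x => d x * g x)| <= e.
Proof.
move=> se gs g1; apply: ler_norm_usum; apply: le_trans se; apply: le_l1 => x.
by case: ifPn => [/gs ->|_]; rewrite ?mulr0// normrM ler_piMr.
Qed.

Lemma l1_boolM (d : R -> R) (P : pred R) : (l1 d < +oo)%E ->
  (l1 (fun x => d x * (P x)%:R)%R < +oo)%E.
Proof.
apply: le_lt_trans; apply: le_l1 => x.
by rewrite normrM ler_piMr// normr_bool_le1.
Qed.

Definition cdf_of (d : R -> R) (y : R) : R := usum (fun x => d x * (x <= y)%R%:R).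

Lemma cdf_of_diff (d : R -> R) (P Q : pred R) : (l1 d < +oo)%E ->
  usum (fun x => d x * (P x)%:R) - usum (fun x => d x * (Q x)%:R) =
  usum (fun x => d x * ((P x)%:R - (Q x)%:R)).
Proof.
move=> sd; rewrite -(usumB (l1_boolM P sd) (l1_boolM Q sd)).
by congr usum; apply/funext => x; rewrite mulrBr.
Qed.

(** Right continuity and both limits at infinity come from this estimate. Predicates replace
    half-lines so that [pred0] and [predT] can stand for the limits. *)
Lemma cdf_of_close (d : R -> R) (s : seq R) (e : R) (P Q : pred R) : (l1 d < +oo)%E ->
  (l1 (fun x => if x \in s then 0 else d x)%R <= e%:E)%E ->
  (forall x, x \in s -> P x = Q x) ->
  `|usum (fun x => d x * (P x)%:R) - usum (fun x => d x * (Q x)%:R)| <= e.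
Proof.
move=> sd se PQ; rewrite cdf_of_diff//.
apply: (usum_vanish se) => x; first by move=> /PQ ->; rewrite subrr.
exact: normr_boolB_le1.
Qed.

Lemma gap_right (s : seq R) (y : R) : exists2 e, 0 < e &
  forall x, x \in s -> x <= y \/ y + e < x.
Proof.
elim: s => [|x s [e e0 IH]]; first by exists 1.
have [xy|yx] := lerP x y.
  by exists e => // z; rewrite inE => /predU1P[->|/IH//]; left.
exists (Num.min e ((x - y) / 2)); first by rewrite lt_min e0 divr_gt0 ?subr_gt0.
move=> z; rewrite inE => /predU1P[->|/IH[zy|zy]]; [right| by left |right].
  have : Num.min e ((x - y) / 2) <= (x - y) / 2 by rewrite ge_min lexx orbT.
  by move: (Num.min _ _) => u; lra.
have : Num.min e ((x - y) / 2) <= e by rewrite ge_min lexx.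
by move: (Num.min _ _) => u; lra.
Qed.

Lemma gap_left (s : seq R) (y : R) : exists2 e, 0 < e &
  forall x, x \in s -> y <= x \/ x < y - e.
Proof.
have [e e0 H] := gap_right (map -%R s) (- y); exists e => // x xs.
have [|h|h] := H (- x); first exact: map_f.
- by left; rewrite -lerN2.
- by right; lra.
Qed.

Lemma seq_bound (s : seq R) : exists M, forall x, x \in s -> `|x| <= M.
Proof.
elim: s => [|x s [M IH]]; first by exists 0.
exists (Num.max `|x| M) => y; rewrite inE le_max => /predU1P[->|/IH ->].
  by rewrite lexx.
by rewrite orbT.
Qed.

Lemma cdf_of_nondecreasing (b : R -> R) : (forall x, 0 <= b x) -> (l1 b < +oo)%E ->
  nondecreasing (cdf_of b).
Proof.
move=> b0 sb u v uv; apply: ler_usum; [exact: l1_boolM|exact: l1_boolM|move=> x].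
rewrite ler_wpM2l// ler_nat; have [xu|//] := leP x u.
by rewrite (le_trans xu uv).
Qed.

Section Cdf.
Context (b : R -> R) (b0 : forall x, 0 <= b x) (b1 : l1 b = 1%:E).

Let sb : (l1 b < +oo)%E. Proof. by rewrite b1 ltry. Qed.

Lemma cdf_of_right_continuous : right_continuous (cdf_of b).
Proof.
move=> y; apply/cvgrPdist_le => e e0.
have [s us se] := l1_tail sb e0.
have [d d0 dP] := gap_right s y.
near=> z.
have yz : y < z by near: z; exact: nbhs_right_gt.
have zd : z < y + d by near: z; apply: nbhs_right_lt; rewrite ltrDl.
apply: (cdf_of_close sb se) => x /dP[xy|xy].
  by rewrite xy (le_trans xy (ltW yz)).
by rewrite !leNgt (lt_trans zd xy) (lt_trans _ xy)// ltrDl.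
Unshelve. all: end_near. Qed.

Lemma cdf_ofNy : cdf_of b @ -oo --> (0 : R).
Proof.
apply/cvgrPdist_le => e e0.
have [s us se] := l1_tail sb e0; have [M MP] := seq_bound s.
near=> y.
have yM : y < - M by near: y; exact: nbhs_ninfty_lt (num_real _).
have -> : 0 = usum (fun x => b x * (pred0 x)%:R).
  by rewrite (_ : (fun x => _) = fun=> 0) ?usum0//; apply/funext => x; rewrite mulr0.
apply: (cdf_of_close sb se) => x /MP; rewrite ler_norml => /andP[Mx _].
by rewrite leNgt (lt_le_trans yM Mx).
Unshelve. all: end_near. Qed.

Lemma cdf_ofy : cdf_of b @ +oo --> (1 : R).
Proof.
apply/cvgrPdist_le => e e0.
have [s us se] := l1_tail sb e0; have [M MP] := seq_bound s.
near=> y.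
have yM : M < y by near: y; exact: nbhs_pinfty_gt (num_real _).
have -> : 1 = usum (fun x => b x * (predT x)%:R).
  rewrite (_ : (fun x => _) = b); last by apply/funext => x; rewrite mulr1.
  by rewrite usum_ge0E// b1.
apply: (cdf_of_close sb se) => x /MP; rewrite ler_norml => /andP[_ xM].
by rewrite /= (le_trans xM (ltW yM)).
Unshelve. all: end_near. Qed.

Lemma cdf_of_distr : exists G : distr_fun R, forall y, G y = cdf_of b y :> R.
Proof.
pose m1 := isCumulative.Build R _ R (cdf_of b)
  (cdf_of_nondecreasing b0 sb) cdf_of_right_continuous.
pose m2 := isCumulativeBounded.Build R 0 1 (cdf_of b) cdf_ofNy cdf_ofy.
by exists (HB.pack_for (cumulativeBounded (0 : R) (1 : R)) (cdf_of b) m1 m2).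
Qed.

Lemma support_enumeration : exists x : nat -> R,
  injective x /\ forall y, b y != 0 -> exists k, x k = y.
Proof.
(* An injective sequence over all of [nat] is required, even if the support is finite. Adjoining the
   natural numbers makes the set infinite; the extra points get weight 0. *)
pose A := [set x | b x != 0] `|` range (fun n : nat => n%:R).
have cA : countable A.
  (* A point of mass above [n.+1%:R^-1] cannot lie outside a finite list whose complement carries at
     most that much. *)
  have H (n : nat) : exists s : seq R, forall x, n.+1%:R^-1 < b x -> x \in s.
    have n0 : 0 < n.+1%:R^-1 :> R by rewrite invr_gt0.
    have [s us se] := l1_tail sb n0; exists s => x; apply: contraTT => xs.
    rewrite -leNgt -lee_fin; apply: le_trans se.
    apply: le_trans (le_norm_l1 _ x); rewrite (negbTE xs) lee_fin.
    exact: ler_norm.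
  have /choice[s sP] := H.
  apply: (@sub_countable _ _ _ (\bigcup_n ([set` s n] `|` [set n%:R]))).
    apply: subset_card_le => x [/= bx|[n _ <-]]; last by exists n => //; right.
    have bx0 : 0 < b x by rewrite lt_neqAle eq_sym bx b0.
    exists (Num.bound (b x)^-1) => //; left; apply: sP.
    rewrite invf_plt ?posrE//; apply: lt_trans (archi_boundP _) _.
      by rewrite invr_ge0.
    by rewrite ltr_nat.
  apply: bigcup_countable => // n _; apply: finite_set_countable.
  by rewrite finite_setU; split; [exact: finite_seq|exact: finite_set1].
have iA : infinite_set A.
  apply: (@sub_infinite_set _ (range (fun n : nat => n%:R : R))).
    by move=> x; right.
  apply/infiniteP; have /card_eqPle[] // : (range (fun n : nat => n%:R : R) #= [set: nat])%card.
  by apply: inj_card_eq => m n _ _ /eqP; rewrite eqr_nat => /eqP.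
have /card_set_bijP[x [xA xi xs]] : ([set: nat] #= A)%card.
  by apply/card_eqPle; split; [exact/infiniteP|exact: cA].
exists x; split; first by move=> i j; apply: xi; rewrite inE.
move=> y yb; have [|k _ kE] := xs y; first by left.
by exists k.
Qed.

(** The converse of [mass_of_is_mass], by which a limit of masses becomes a distribution function
    again. *)
Lemma mass_realized : exists G : distr_fun R,
  [/\ exists x p, discrete_repr G x p, forall y, G y = cdf_of b y :> R &
      forall t, char_fun G t = ft b t].
Proof.
have [G GE] := cdf_of_distr; exists G.
have [x [xi xs]] := support_enumeration.
pose p k := b (x k).
have p0 k : 0 <= p k by exact: b0.
have push (g : R -> R) : (forall y, `|g y| <= 1) ->
    (l1 (fun k => p k * g (x k))%R < +oo)%E /\
    usum (fun k => p k * g (x k)) = usum (fun y => b y * g y).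
  move=> g1; pose f k y := b y * g y * (x k == y)%:R.
  have f0 k y : y != x k -> f k y = 0.
    by move=> yx; rewrite /f eq_sym (negbTE yx) mulr0.
  have fE y : (usum (fun k => f k y) = b y * g y) * (l1 (fun k => f k y) = `|b y * g y|%:E)%E.
    have [by0|/xs[j <-]] := eqVneq (b y) 0.
      have -> : (fun k => f k y) = (fun=> 0).
        by apply/funext => k; rewrite /f by0 !mul0r.
      rewrite by0 mul0r normr0 usum0; split => //.
      by rewrite l1E esum1// => k _; rewrite normr0.
    have z k : k != j -> f k (x j) = 0.
      by move=> kj; rewrite /f (inj_eq xi) (negbTE kj) mulr0.
    by rewrite (usum_single z) (l1_single z) /f eqxx mulr1.
  have sf : (\esum_(y in setT) l1 (fun k => f k y) < +oo)%E.
    rewrite (_ : (fun y => _) = (fun y => `|b y * g y|%:E)); last first.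
      by apply/funext => y; rewrite fE.
    rewrite -(@l1E _ _ (fun y => b y * g y)); apply: le_lt_trans sb; apply: le_l1 => y.
    by rewrite normrM ler_piMr.
  have pfE k : p k * g (x k) = usum (f k) by rewrite (usum_single (f0 k)) /f eqxx mulr1.
  have -> : (fun k => p k * g (x k)) = (fun k => usum (f k)) by exact/funext.
  have sf' := sf; rewrite (@l1_swap _ _ _ (fun y k => f k y)) in sf'.
  split; first exact: (@l1_usum_fin _ _ _ f).
  by rewrite (@usum_swap _ _ _ f)//; congr usum; apply/funext => y; rewrite fE.
have one (T : choiceType) (h : T -> R) : (fun k => h k * 1) = h.
  by apply/funext => k; rewrite mulr1.
have [|pl pE] := push (fun=> 1); first by move=> y; rewrite normr1.
rewrite !one in pl pE.
have Gxp : discrete_repr G x p.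
  split => //.
    have -> : 1 = usum p by rewrite pE (usum_ge0E sb b0) b1.
    exact: usum_nat_cvg.
  move=> y; have [|yl yE] := push (fun z => (z <= y)%R%:R).
    by move=> z; exact: normr_bool_le1.
  by rewrite GE /cdf_of -yE; exact: usum_nat_cvg.
split => // [|t]; first by exists x, p.
rewrite (char_fun_mass_of Gxp); congr (ft _ t); apply/funext => y.
rewrite /mass_of; have [|_ ->] := push (fun z => (z == y)%:R).
  by move=> z; exact: normr_bool_le1.
by rewrite (@usum_single _ _ y) ?eqxx ?mulr1// => z /negbTE ->; rewrite mulr0.
Qed.

End Cdf.

(** * Total variation compared with the norm of the masses *)

(** A finite list carries all but [e] of the masses. If the left end [u] lies in its gap just below
    [x], the increment from [u] to [x] sees at most the point [x] of this list, so it is [d x] up to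
    [e]. *)
Lemma total_variation_ge_mass (d : R -> R) (lo x : R) : (l1 d < +oo)%E -> lo < x ->
  (`|d x|%:E <= total_variation lo x (cdf_of d))%E.
Proof.
move=> sd lox; apply/lee_addgt0Pr => e e0.
have [s us se] := l1_tail sd e0.
have [g g0 gP] := gap_left s x.
pose u := Num.max lo (x - g).
have ux : u < x by rewrite gt_max lox gtrBl.
have lou : lo <= u by rewrite le_max lexx.
have H : `|d x| <= `|cdf_of d x - cdf_of d u| + e.
  have -> : d x = usum (fun y => d y * (y == x)%:R).
    by rewrite (@usum_single _ _ x) ?eqxx ?mulr1// => z /negbTE ->; rewrite mulr0.
  set D := cdf_of d x - cdf_of d u; set S := usum _.
  rewrite -lerBlDl; apply: le_trans (lerB_dist _ _) _.
  rewrite distrC /D /cdf_of /S (cdf_of_diff (fun y => y <= x) (fun y => y <= u) sd).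
  have lx : (l1 (fun y => d y * (y == x)%:R)%R < +oo)%E by exact: l1_boolM (pred1 x) sd.
  have ld : (l1 (fun y => d y * ((y <= x)%R%:R - (y <= u)%R%:R))%R < +oo)%E.
    apply: le_lt_trans sd; apply: le_l1 => y; rewrite normrM ler_piMr//.
    exact: normr_boolB_le1.
  rewrite -usumB//.
  rewrite (_ : (fun y => _) = (fun y => d y * ((y <= x)%R%:R - (y <= u)%R%:R - (y == x)%:R))); last first.
    by apply/funext => y; ring.
  apply: (usum_vanish se) => y.
    move=> /gP[xy|yx].
      have -> : (y <= u) = false by rewrite leNgt (lt_le_trans ux xy).
      by rewrite eq_le xy andbT subr0 subrr.
    have yu : y < u by rewrite lt_max yx orbT.
    by rewrite (ltW yu) (ltW (lt_trans yu ux)) (lt_eqF (lt_trans yu ux)) subrr subr0.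
  have [->|yx] := eqVneq y x.
    by rewrite lexx (leNgt x u) ux /= !subr0 subrr normr0.
  by rewrite subr0; exact: normr_boolB_le1.
rewrite (total_variationD _ lou (ltW ux)).
apply: (@le_trans _ _ (`|cdf_of d x - cdf_of d u| + e)%:E); first by rewrite lee_fin.
rewrite EFinD; apply: leeD => //.
apply: le_trans (total_variation_ge _ (ltW ux)) _.
by apply: leeDr; exact: total_variation_ge0.
Qed.

Lemma total_variation_ge_path (d : R -> R) (s : seq R) (lo : R) : (l1 d < +oo)%E ->
  path <%R lo s ->
  ((\sum_(x <- s) `|d x|)%:E <= total_variation lo (last lo s) (cdf_of d))%E.
Proof.
move=> sd; elim: s lo => [|x s IH] lo /=.
  by rewrite big_nil total_variationxx.
move=> /andP[lox ps].
have xl : x <= last x s.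
  elim: s x ps {IH lox} => //= y s IH x /andP[xy /IH].
  exact: le_trans (ltW xy).
rewrite big_cons EFinD (total_variationD _ (ltW lox) xl).
by apply: leeD; [exact: total_variation_ge_mass|exact: IH].
Qed.

(** After sorting, the intervals between successive points each end at one point and contribute at
    least its mass; the variation is additive over them. *)
Lemma l1_le_total_variationR (d : R -> R) : (l1 d < +oo)%E ->
  (l1 d <= total_variationR (cdf_of d))%E.
Proof.
move=> sd; rewrite l1E; apply: ge_ereal_sup => _ [X [finX _] <-].
rewrite fsbig_finite//= sumEFin.
set s := (X in \sum_(_ <- X) _).
have us : uniq s by exact: finmap.fset_uniq.
rewrite -(perm_big _ (permEl (perm_sort <=%R s))) /=.
have : sorted <%R (sort <=%R s) by rewrite sort_lt_sorted.
case sortE : (sort _ s) => [|x r] /= pr.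
  rewrite big_nil; apply: ereal_sup_ubound => /=.
  by exists (0, 0) => //=; rewrite total_variationxx.
(* Any starting point to the left of the smallest atom serves. *)
have p : path <%R (x - 1) (x :: r) by rewrite /= pr gtrBl ltr01.
apply: le_trans (total_variation_ge_path sd p) _.
apply: ereal_sup_ubound => /=; exists (x - 1, last (x - 1) (x :: r)) => //=.
have : x - 1 <= x by rewrite gerBl.
move/le_trans; apply.
elim: r x pr {sortE p} => //= y r IH x /andP[xy /IH].
exact: le_trans (ltW xy).
Qed.

(** The positive and negative parts give monotone functions, each varying by at most its own mass.
    Bounding both masses by [l1 d] gives the factor 2. *)
Lemma total_variationR_le_l1 (d : R -> R) : (l1 d < +oo)%E ->
  (total_variationR (cdf_of d) <= 2%:E * l1 d)%E.
Proof.
move=> sd; apply: ge_ereal_sup => _ [[u v] /= uv <-].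
have [q [n [q0 n0 qd nd dE]]] := posneg d.
have sq : (l1 q < +oo)%E by exact: le_lt_trans (le_l1 qd) sd.
have sn : (l1 n < +oo)%E by exact: le_lt_trans (le_l1 nd) sd.
have cdfE : cdf_of d = cdf_of q \+ (\- cdf_of n).
  apply/funext => y; rewrite /cdf_of /=.
  rewrite -(usumB (l1_boolM (fun x => x <= y) sq) (l1_boolM (fun x => x <= y) sn)).
  by congr usum; apply/funext => x; rewrite dE mulrBl.
have H (r : R -> R) : (forall x, 0 <= r x) -> (l1 r < +oo)%E ->
    (total_variation u v (cdf_of r) <= l1 r)%E.
  move=> r0 sr; rewrite nondecreasing_total_variation//; last first.
    by move=> x y _ _; exact: cdf_of_nondecreasing.
  rewrite -[leRHS]fineK ?l1_fin_num// lee_fin -(usum_ge0E sr r0).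
  have : cdf_of r v <= usum r.
    apply: ler_usum => //; first exact: l1_boolM.
    by move=> x; rewrite ler_piMr// -(ger0_norm (ler0n _ _)) normr_bool_le1.
  have : 0 <= cdf_of r u.
    rewrite /cdf_of usum_ge0E ?fine_ge0 ?l1_ge0//; first exact: l1_boolM.
    by move=> x; rewrite mulr_ge0.
  lra.
rewrite cdfE; apply: le_trans (total_variation_le _ _ uv) _.
rewrite total_variationN mule_natl mule2n; apply: leeD.
  exact: le_trans (H q q0 sq) (le_l1 qd).
exact: le_trans (H n n0 sn) (le_l1 nd).
Qed.

End Discrete.

(** * Convergence in variation as convergence of masses *)

Section Convergence.
Local Open Scope complex_scope.
Context {R : realType}.
Implicit Types (F G : distr_fun R) (a b d : R -> R).

Lemma cvge0P (v : nat -> \bar R) : (forall n, 0 <= v n)%E ->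
  v @ \oo --> 0%E <->
  forall e : R, 0 < e -> exists N, forall n, (N <= n)%N -> (v n <= e%:E)%E.
Proof.
move=> v0; split=> [/fine_cvgP[[N1 _ N1P] /cvgrPdist_le cv] e e0|H].
  have [N2 _ N2P] := cv e e0; exists (maxn N1 N2) => n.
  rewrite geq_max => /andP[n1 n2].
  have := N2P n n2; rewrite /= sub0r normrN ger0_norm ?fine_ge0// -lee_fin fineK//.
  exact: N1P.
apply/fine_cvgP; split.
  have [N NP] := H 1 ltr01; exists N => // n /= /NP h.
  by rewrite ge0_fin_numE//; apply: le_lt_trans h (ltry _).
apply/cvgrPdist_le => e e0; have [N NP] := H e e0; exists N => // n /= /NP h.
rewrite sub0r normrN ger0_norm ?fine_ge0// -lee_fin fineK//.
by rewrite ge0_fin_numE//; apply: le_lt_trans h (ltry _).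
Qed.

Lemma D_S_mass F : D_S F -> exists a, is_mass F a /\ forall t, char_fun F t = ft a t.
Proof.
move=> [[x [p Fxp]] _]; exists (mass_of x p); split.
  exact: mass_of_is_mass.
by move=> t; exact: char_fun_mass_of.
Qed.

Lemma is_mass_fin F a : is_mass F a -> (l1 a < +oo)%E.
Proof. by case=> _ -> _; rewrite ltry. Qed.

Lemma l1B_fin a b : (l1 a < +oo)%E -> (l1 b < +oo)%E ->
  (l1 (fun x => a x - b x)%R < +oo)%E.
Proof. by move=> sa sb; apply: l1D_fin; rewrite ?l1N. Qed.

Lemma total_variationR_ge0 (f : R -> R) : (0 <= total_variationR f)%E.
Proof.
apply: ereal_sup_ubound; exists (0, 0) => //=.
by rewrite total_variationxx.
Qed.

Lemma cvg_in_variationP (F : nat -> distr_fun R) G (a : nat -> R -> R) b :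
  (forall n, is_mass (F n) (a n)) -> (l1 b < +oo)%E ->
  (forall y, G y = cdf_of b y :> R) ->
  cvg_in_variation F G <-> forall e, 0 < e -> exists N, forall n, (N <= n)%N ->
    (l1 (fun x => a n x - b x)%R <= e%:E)%E.
Proof.
move=> Fa sb Gb.
have sa n := is_mass_fin (Fa n).
have FG n : (fun y => F n y - G y) = cdf_of (fun x => a n x - b x).
  apply/funext => y; have [_ _ ->] := Fa n; rewrite Gb /cdf_of.
  rewrite -(usumB (l1_boolM (fun x => x <= y) (sa n)) (l1_boolM (fun x => x <= y) sb)).
  by congr usum; apply/funext => x; rewrite mulrBl.
rewrite /cvg_in_variation cvge0P; last by move=> n; exact: total_variationR_ge0.
split=> H e e0.
  have [N NP] := H e e0; exists N => n /NP; apply: le_trans; rewrite FG.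
  exact/l1_le_total_variationR/l1B_fin.
have [N NP] := H (e / 2) (divr_gt0 e0 (ltr0Sn _ _)); exists N => n /NP h.
rewrite FG; apply: le_trans (total_variationR_le_l1 (l1B_fin (sa n) sb)) _.
rewrite (_ : e = 2 * (e / 2)); last by rewrite mulrC divfK.
by rewrite EFinM; apply: lee_wpmul2l.
Qed.

(** Convergence in norm makes the total sum continuous, so no mass escapes in the limit. *)
Lemma mass_limit (a : nat -> R -> R) b : (forall n x, 0 <= a n x) ->
  (forall n, l1 (a n) = 1%:E) -> (forall x, a ^~ x @ \oo --> b x) ->
  (forall e, 0 < e -> exists N, forall n, (N <= n)%N ->
    (l1 (fun x => a n x - b x)%R <= e%:E)%E) ->
  (forall x, 0 <= b x) /\ l1 b = 1%:E.
Proof.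
move=> a0 a1 ab H.
have b0 x : 0 <= b x.
  by apply: (cvgr_to_ge (ab x)); apply: nearW => n; exact: a0.
have sa n : (l1 (a n) < +oo)%E by rewrite a1 ltry.
have sb : (l1 b < +oo)%E.
  have [N /(_ N (leqnn N)) NP] := H 1 ltr01.
  have -> : b = (fun x => a N x - (a N x - b x)) by apply/funext => x; ring.
  by apply: l1B_fin => //; apply: le_lt_trans NP (ltry _).
split=> //; rewrite -[LHS]fineK ?l1_fin_num//; congr _%:E.
rewrite -(usum_ge0E sb b0); apply/eqP; rewrite -subr_eq0 -normr_le0.
apply/ler_addgt0Pr => e e0; rewrite add0r; have [N /(_ N (leqnn N)) NP] := H e e0.
have s1 : usum (a N) = 1 by rewrite (usum_ge0E (sa N) (a0 N)) a1.
by rewrite -s1 distrC -usumB//; exact: ler_norm_usum.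
Qed.

Lemma cdf_of_D_S b mu : (forall x, 0 <= b x) -> l1 b = 1%:E -> 0 < mu ->
  (forall t, mu <= normc (ft b t)) ->
  exists2 G, D_S G & forall y, G y = cdf_of b y :> R.
Proof.
move=> b0 b1 mu0 bmu; have [G [Gr Gb Gf]] := mass_realized b0 b1.
exists G => //; split => //; exists mu => // t.
by rewrite Gf -normc_abs lecR.
Qed.

End Convergence.

(** * The compactness criterion *)

Section Tails.
Local Open Scope complex_scope.
Context {R : realType} {K : set nat} {u : nat -> R}.
Implicit Types (l : R -> R).

Definition tail_set (N : nat) : set R :=
  (u @` [set k | K k /\ (N < k)%N]) `\ 0%R.

Definition tail (N : nat) l (x : R) : R := if x \in tail_set N then l x else 0.

Lemma tail_set_mono N M x : (N <= M)%N -> tail_set M x -> tail_set N x.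
Proof.
by move=> NM [[k [Kk Mk] <-] x0]; split=> //; exists k => //; split=> //; exact: leq_ltn_trans Mk.
Qed.

Lemma le_l1_tail N l : (l1 (tail N l) <= l1 l)%E.
Proof. by apply: le_l1 => x; rewrite /tail; case: ifP => //; rewrite normr0. Qed.

Lemma l1_tail_mono N M l : (N <= M)%N -> (l1 (tail M l) <= l1 (tail N l))%E.
Proof.
move=> NM; apply: le_l1 => x; rewrite /tail.
case: ifPn => [|_]; last by rewrite normr0.
by rewrite inE => /(tail_set_mono NM) h; rewrite mem_set.
Qed.

Lemma l1_tailB N l l' :
  (l1 (tail N l) <= l1 (fun x => l x - l' x)%R + l1 (tail N l'))%E.
Proof.
apply: le_trans (leeD (le_l1_tail N (fun x => l x - l' x)) (lexx _)).
apply: le_trans (l1D _ _); apply: le_l1 => x; rewrite /tail.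
by case: ifP => _; rewrite ?addr0// subrK.
Qed.

Context (uK : set_inj K u).

(** By injectivity on [K] each point of a finite list has at most one index, so beyond some [N] the
    enumeration avoids the list. *)
Lemma l1_tail_small l e : (l1 l < +oo)%E -> 0 < e ->
  exists N, (l1 (tail N l) <= e%:E)%E.
Proof.
move=> sl e0; have [s us se] := l1_tail sl e0.
have [N NP] : exists N, forall k, K k -> u k \in s -> (k <= N)%N.
  elim: s {us se} => [|x s [N IH]]; first by exists 0%N.
  have [[k [Kk kx]]|H] := pselect (exists k, K k /\ u k = x).
    exists (maxn N k) => j Kj; rewrite inE leq_max => /predU1P[jx|/IH -> //].
    have -> : j = k by apply: uK; rewrite ?inE// jx.
    by rewrite leqnn orbT.
  exists N => j Kj; rewrite inE => /predU1P[jx|/IH -> //].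
  by exfalso; apply: H; exists j.
exists N; apply: le_trans se; apply: le_l1 => x; rewrite /tail.
case: ifPn; last by rewrite normr0.
rewrite inE => -[[k [Kk Nk] <-] _]; case: ifPn => // /(NP _ Kk).
by rewrite leqNgt Nk.
Qed.

Lemma l1_tail_small_finite (l : nat -> R -> R) n e :
  (forall m, l1 (l m) < +oo)%E -> 0 < e ->
  exists N, forall m, (m < n)%N -> (l1 (tail N (l m)) <= e%:E)%E.
Proof.
move=> sl e0; elim: n => [|n [N IH]]; first by exists 0%N.
have [M MP] := l1_tail_small (sl n) e0.
exists (maxn N M) => m; rewrite ltnS leq_eqVlt => /predU1P[->|/IH h].
  by apply: le_trans MP; apply: l1_tail_mono; rewrite leq_maxr.
by apply: le_trans h; apply: l1_tail_mono; rewrite leq_maxl.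
Qed.

(** Off the tail set only the points [u 0] to [u N] can matter, each contributing at most [d]; each
    of the two tails costs [e]. *)
Lemma l1_le_head_tail N l l' d e :
  (forall x, l x != 0 -> tail_set N x \/ exists2 k, (k <= N)%N & u k = x) ->
  (forall x, l' x != 0 -> tail_set N x \/ exists2 k, (k <= N)%N & u k = x) ->
  (forall k, (k <= N)%N -> `|l (u k) - l' (u k)| <= d) ->
  (l1 (tail N l) <= e%:E)%E -> (l1 (tail N l') <= e%:E)%E ->
  (l1 (fun x => l x - l' x)%R <= (N.+1%:R * d + e + e)%:E)%E.
Proof.
move=> lH l'H lk le l'e.
rewrite (l1_split (fun x => ~~ (x \in tail_set N))) -addrA EFinD; apply: leeD.
  (* Indices up to [N] may leave [K], where [u] can repeat values. *)
  pose s := undup (map u (iota 0 N.+1)).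
  rewrite (@l1_finsupp _ _ s) ?undup_uniq//; last first.
    move=> x; rewrite mem_undup => xs; case: ifPn => // xt.
    have H (f : R -> R) : (forall x, f x != 0 -> tail_set N x \/ exists2 k, (k <= N)%N & u k = x) -> f x = 0.
      move=> fH; apply/eqP/negPn/negP => /fH[xT|[k kN kx]].
        by move/negP: xt; apply; rewrite inE.
      by move/negP: xs; apply; apply/mapP; exists k => //; rewrite mem_iota /= add0n ltnS.
    by rewrite !H// subrr.
  rewrite lee_fin; have d0 : 0 <= d by apply: le_trans (lk 0%N _).
  apply: (@le_trans _ _ (\sum_(x <- s) d)).
    rewrite big_seq [leRHS]big_seq; apply: ler_sum => x.
    rewrite mem_undup => /mapP[k]; rewrite mem_iota /= add0n ltnS => kN ->.
    by case: ifP => _; [exact: lk|rewrite normr0].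
  rewrite big_const_seq count_predT iter_addr_0 -[d *+ _]mulr_natl; apply: ler_wpM2r => //.
  by rewrite ler_nat; apply: leq_trans (size_undup _) _; rewrite size_map size_iota.
apply: (@le_trans _ _ (l1 (tail N l) + l1 (tail N l'))%E); last by rewrite EFinD; exact: leeD.
rewrite -(l1N (tail N l')); apply: le_trans (l1D _ _); apply: le_l1 => x.
by rewrite /tail; case: (x \in _); rewrite //= subr0.
Qed.

End Tails.
Arguments tail_set {R} K u N.
Arguments tail {R} K u N l.

(** * Necessity and sufficiency of the three conditions *)

Section Main.
Local Open Scope complex_scope.
Context {R : realType}.
Context (F : nat -> distr_fun R) (gamma : nat -> R) (lambda : nat -> R -> R)
  (K : set nat) (u : nat -> R)
  (F_D_S : forall n, D_S (F n))
  (F_spectral : forall n, spectral_parameters (F n) (gamma n) (lambda n))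
  (lambda_out : forall n v,
     ~ zspan (growth_points (F n)) v -> lambda n v = 0)
  (u_enum : enumerates K u (\bigcup_n zspan (growth_points (F n)))).

(* The value of [lambda n] at 0 is arbitrary. *)
Let lam n v := if v == 0 then 0 else lambda n v.

Let lam0 n : lam n 0 = 0. Proof. by rewrite /lam eqxx. Qed.

Let lam_mkcond n : (fun v => if v \in zspan (growth_points (F n)) `\ 0 then lambda n v else 0) = lam n.
Proof.
apply/funext => v; rewrite /lam; have [->|v0] := eqVneq v 0.
  by rewrite memNset// => -[_]; apply.
case: ifPn => // /negP; rewrite inE => vS; apply/esym/lambda_out => Sv.
by apply: vS; split => //; exact/eqP.
Qed.

Let lam_esum n :
  (\esum_(v in zspan (growth_points (F n)) `\ 0%R) `|lambda n v|%:E = l1 (lam n))%E.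
Proof. by rewrite esum_abs_mkcond lam_mkcond. Qed.

Let tail_esum n N :
  (\esum_(v in (u @` [set k | K k /\ (N < k)%N]) `\ 0%R) `|lambda n v|%:E =
   l1 (tail K u N (lam n)))%E.
Proof.
rewrite esum_abs_mkcond; congr l1; apply/funext => v; rewrite /tail /tail_set.
by case: ifPn => //; rewrite inE => -[_ /eqP/negbTE v0]; rewrite /lam v0.
Qed.

Let lam_fin n : (l1 (lam n) < +oo)%E.
Proof.
have [_ + _] := F_spectral n; rewrite /summable /= => h.
by rewrite -lam_esum.
Qed.

Let lam_supp n N x : lam n x != 0 -> tail_set K u N x \/ exists2 k, (k <= N)%N & u k = x.
Proof.
rewrite /lam; have [->|x0 lx] := eqVneq x 0; first by rewrite eqxx.
have Sx : zspan (growth_points (F n)) x.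
  by apply: contrapT => /lambda_out l0; rewrite l0 eqxx in lx.
have [_ _ uE] := u_enum.
have : (\bigcup_n zspan (growth_points (F n))) x by exists n.
rewrite -uE => -[k Kk kx]; have [kN|Nk] := leqP k N; first by right; exists k.
by left; split; [exists k|exact/eqP].
Qed.

Let char_spec n t : char_fun (F n) t = cexp (spec (gamma n) (lam n) t).
Proof.
have [_ _ ->] := F_spectral n; rewrite csum_mkcond; congr (cexp (_ + cusum _)).
apply/funext => v; rewrite -eit_cexp -lam_mkcond.
by case: ifP => // _; rewrite mul0r.
Qed.

Let masses : exists a : nat -> R -> R, forall n, is_mass (F n) (a n) /\
  forall t, ft (a n) t = cexp (spec (gamma n) (lam n) t).
Proof.
have /choice[a aP] n := D_S_mass (F_D_S n).
exists a => n; have [Fa fE] := aP n; split => // t.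
by rewrite -char_spec fE.
Qed.

Let uK : set_inj K u. Proof. by have [] := u_enum. Qed.

Let cauchy_on (phi : nat -> nat) := forall e, 0 < e -> exists N, forall n m,
  (N <= n)%N -> (N <= m)%N -> gamma (phi n) = gamma (phi m) /\
  (l1 (fun x => lam (phi n) x - lam (phi m) x)%R <= e%:E)%E.

(** The common core of the three necessity proofs, which then speak of the parameters only. *)
Let relatively_compact_cauchy (phi : nat -> nat) :
  D_S_relatively_compact F -> increasing_seq phi ->
  exists2 psi : nat -> nat, increasing_seq psi & cauchy_on (phi \o psi).
Proof.
move=> RC iphi; have [psi ipsi [G GD GF]] := RC phi iphi; exists psi => //.
have [a aP] := masses; have [b [Gb bE]] := D_S_mass GD.
have [_ [mu mu0 muP]] := GD; have [_ b1 Gy] := Gb.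
have Fm n : is_mass (F (phi (psi n))) (a (phi (psi n))) by have [] := aP (phi (psi n)).
apply: (@spec_cauchy _ (fun n => a (phi (psi n))) b _ _ mu).
- by move=> n t; have [_ ->] := aP (phi (psi n)).
- by move=> n; exact: lam_fin.
- by move=> n; exact: lam0.
- by move=> n; exact: is_mass_fin (Fm n).
- by rewrite b1.
- by [].
- by move=> t; have := muP t; rewrite bE -normc_abs lecR.
- exact/(cvg_in_variationP Fm (is_mass_fin Gb) Gy).
Qed.

Let necessity_gamma : D_S_relatively_compact F -> finite_set (range gamma).
Proof.
move=> RC; apply: contrapT => inf.
(* Level [k] asks for a value different from all those with index up to [k]. If no such [n >= N]
   existed, the first [maxn k N + 1] indices would give all the values. *)
have [k N|phi iphi phiP] := @bad_subsequence (fun k n => forall j, (j <= k)%N -> gamma n <> gamma j).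
  apply: contrapT => H; apply: inf.
  apply: (@sub_finite_set _ _ [set` map gamma (iota 0 (maxn k N).+1)]); last exact: finite_seq.
  have mem j : (j <= maxn k N)%N -> gamma j \in map gamma (iota 0 (maxn k N).+1).
    by move=> jm; apply: map_f; rewrite mem_iota add0n ltnS.
  move=> _ [n _ <-] /=; have [nN|Nn] := leqP n N.
    by apply: mem; rewrite leq_max nN orbT.
  apply: contrapT => gn; apply: H; exists n; first exact: ltnW.
  move=> j jk gj; apply: gn; rewrite gj; apply: mem.
  by rewrite leq_max jk.
have [psi ipsi cpsi] := relatively_compact_cauchy RC iphi.
have [N NP] := cpsi 1 ltr01.
(* The level [psi i] then covers the index [phi (psi N)], so the two values of [gamma] must differ
   although the Cauchy property makes them equal. *)
pose i := maxn N (phi (psi N)).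
have [gE _] := NP i N (leq_maxl _ _) (leqnn N).
apply: (phiP (psi i) (phi (psi N))) => //.
exact: leq_trans (leq_maxr N _) (increasing_seq_ge i ipsi).
Qed.

Let necessity_bounded : D_S_relatively_compact F ->
  (ereal_sup (range (fun n => l1 (lam n))) < +oo)%E.
Proof.
move=> RC; apply: contrapT => inf.
have [k N|phi iphi phiP] := @bad_subsequence (fun k n => k%:R%:E < l1 (lam n))%E.
  apply: contrapT => H; apply: inf.
  have l0 n : 0 <= fine (l1 (lam n)) by rewrite fine_ge0 ?l1_ge0.
  apply: (@le_lt_trans _ _ (k%:R + \sum_(j < N) fine (l1 (lam j)))%:E _ _ _ (ltry _)).
  apply: ge_ereal_sup => _ [n _ <-]; have [nN|Nn] := ltnP n N.
    rewrite -[leLHS]fineK ?l1_fin_num// lee_fin (bigD1 (Ordinal nN))//= addrCA.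
    by rewrite lerDl addr_ge0// sumr_ge0.
  apply: (@le_trans _ _ k%:R%:E); last by rewrite lee_fin lerDl sumr_ge0.
  by rewrite leNgt; apply/negP => h; apply: H; exists n.
have [psi ipsi cpsi] := relatively_compact_cauchy RC iphi.
have [N NP] := cpsi 1 ltr01.
(* By the Cauchy property with tolerance 1, [B] bounds the norms from the [N]-th term on, while the
   norm at step [i] exceeds [psi i >= B]. *)
pose B := 1 + fine (l1 (lam (phi (psi N)))).
have B0 : 0 <= B by rewrite addr_ge0// fine_ge0 ?l1_ge0.
pose i := maxn N (Num.bound B).
have [_ le1] := NP i N (leq_maxl _ _) (leqnn N).
have := phiP (psi i); rewrite ltNge => /negP; apply.
apply: (@le_trans _ _ B%:E).
  rewrite EFinD fineK ?l1_fin_num//; apply: le_trans (leeD le1 (lexx _)).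
  apply: le_trans (l1D _ _); apply: le_l1 => x.
  by rewrite /= subrK.
rewrite lee_fin; apply: le_trans (ltW (archi_boundP B0)) _; rewrite ler_nat.
exact: leq_trans (leq_maxr N _) (increasing_seq_ge i ipsi).
Qed.

Let necessity_tail : D_S_relatively_compact F ->
  ereal_sup (range (fun n => l1 (tail K u N (lam n)))) @[N --> \oo] --> 0%E.
Proof.
move=> RC; apply/cvge0P.
  move=> N; apply: le_trans (l1_ge0 (tail K u N (lam 0%N))) _.
  by apply: ereal_sup_ubound; exists 0%N.
move=> e e0; apply: contrapT => H.
have bad N : exists n, (e%:E < l1 (tail K u N (lam n)))%E.
  apply: contrapT => Hn; apply: H; exists N => M NM.
  apply: ge_ereal_sup => _ [n _ <-]; apply: le_trans (l1_tail_mono _ NM) _.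
  by rewrite leNgt; apply/negP => h; apply: Hn; exists n.
have [k N|phi iphi phiP] := @bad_subsequence (fun k n => e%:E < l1 (tail K u k (lam n)))%E.
  (* The finitely many families with index below [N] have small tails beyond a common [M]; an index
     that is bad at level [maxn k M] is therefore at least [N]. *)
  have [M MP] := l1_tail_small_finite uK N lam_fin e0.
  have [n nP] := bad (maxn k M); exists n.
    rewrite leqNgt; apply/negP => /MP; rewrite leNgt => /negP; apply.
    by apply: lt_le_trans nP _; apply: l1_tail_mono; rewrite leq_maxr.
  by apply: lt_le_trans nP _; apply: l1_tail_mono; rewrite leq_maxl.
have [psi ipsi cpsi] := relatively_compact_cauchy RC iphi.
have e2 : 0 < e / 2 by rewrite divr_gt0.
have [N NP] := cpsi _ e2.
have [M MP] := l1_tail_small uK (lam_fin (phi (psi N))) e2.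
pose i := maxn N M.
have [_ le1] := NP i N (leq_maxl _ _) (leqnn N).
have := phiP (psi i); rewrite ltNge => /negP; apply.
apply: le_trans (l1_tailB _ _ (lam (phi (psi N)))) _.
rewrite (_ : e = e / 2 + e / 2); last by rewrite -splitr.
rewrite EFinD; apply: leeD => //; apply: le_trans MP; apply: l1_tail_mono.
exact: leq_trans (leq_maxr N _) (increasing_seq_ge i ipsi).
Qed.

Let sufficiency (C : R) : finite_set (range gamma) ->
  (forall n, l1 (lam n) <= C%:E)%E ->
  ereal_sup (range (fun n => l1 (tail K u N (lam n)))) @[N --> \oo] --> 0%E ->
  D_S_relatively_compact F.
Proof.
move=> gfin lC /cvge0P tl phi iphi.
have {}tl e : 0 < e -> exists N, forall n, (l1 (tail K u N (lam n)) <= e%:E)%E.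
  move=> e0; have [|N NP] := tl _ e e0.
    move=> N; apply: le_trans (l1_ge0 (tail K u N (lam 0%N))) _.
    by apply: ereal_sup_ubound; exists 0%N.
  exists N => n; apply: le_trans (NP N (leqnn N)).
  by apply: ereal_sup_ubound; exists n.
have tj (j : nat) : exists N, forall n, (l1 (tail K u N (lam n)) <= (j.+1%:R^-1)%:E)%E.
  by apply: tl; rewrite invr_gt0.
have /choice[N NP] := tj.
(* The [(N j).+1] head coefficients together contribute [1 / (j + 1)]; with the two tails this gives
   the [3 / (j + 1)] below. *)
pose d (j : nat) : R := j.+1%:R^-1 / (N j).+1%:R.
have d0 j : 0 < d j by rewrite divr_gt0 ?invr_gt0.
have [j|psi ipsi psiP] := @diagonal_subsequence (fun j m n =>
    gamma (phi m) = gamma (phi n) /\ forall k, (k < (N j).+1)%N ->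
    `|lam (phi m) (u k) - lam (phi n) (u k)| <= d j).
  apply: thinnable_and.
    apply: (@thinnable_finite _ (fun n => gamma (phi n))).
    by apply: sub_finite_set gfin => _ [n _ <-]; exists (phi n).
  apply: (thinnable_forall (r := fun k m n => `|lam (phi m) (u k) - lam (phi n) (u k)| <= d j)) => k.
  apply: (@thinnable_real _ (fun n => lam (phi n) (u k)) C _ (d0 j)) => n.
  by rewrite -lee_fin; apply: le_trans (le_norm_l1 _ _) (lC _).
exists psi => //.
have [a aP] := masses.
pose a' n := a (phi (psi n)); pose lam' n := lam (phi (psi n)).
have Fm n : is_mass (F (phi (psi n))) (a' n) by have [] := aP (phi (psi n)).
have a'0 n x : 0 <= a' n x by have [+ _ _] := Fm n; exact.
have a'1 n : l1 (a' n) = 1%:E by have [] := Fm n.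
have lamc j n m : (j <= n)%N -> (j <= m)%N ->
    (l1 (fun x => lam' n x - lam' m x)%R <= (3 / j.+1%:R)%:E)%E.
  move=> jn jm; have [_ H] := psiP j n m jn jm.
  apply: le_trans (l1_le_head_tail (lam_supp (N j)) (lam_supp (N j)) _ (NP j _) (NP j _)) _.
    by move=> k kN; apply: H; rewrite ltnS.
  have -> : (N j).+1%:R * d j = j.+1%:R^-1 by rewrite /d mulrC divfK ?pnatr_eq0.
  by rewrite lee_fin; move: (_^-1) => v; lra.
have ac e : 0 < e -> exists J, forall n m, (J <= n)%N -> (J <= m)%N ->
    (l1 (fun x => a' n x - a' m x)%R <= e%:E)%E.
  (* [spec_close] turns [3 / (J + 1)] into [12 / (J + 1)], which has to be at most [e]; the summand
     12 secures its hypothesis [3 / (J + 1) <= 1 / 4]. *)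
  move=> e0; pose J := Num.bound (12 + 12 / e); exists J => n m Jn Jm.
  have J0 : 0 <= 12 + 12 / e by rewrite addr_ge0// divr_ge0// ltW.
  have := archi_boundP J0; rewrite -/J => JP.
  have J1 : 12 <= J.+1%:R :> R.
    have : 0 <= 12 / e by rewrite divr_ge0// ltW.
    by rewrite -natr1; lra.
  have Je : 12 <= J.+1%:R * e.
    rewrite -ler_pdivrMr// -natr1; lra.
  have JJ : 0 < J.+1%:R :> R by [].
  have [gE _] := psiP J n m Jn Jm.
  apply: (@le_trans _ _ (4 * (3 / J.+1%:R))%:E); last first.
    by rewrite lee_fin mulrA ler_pdivrMr//; lra.
  apply: (@spec_close _ _ _ (gamma (phi (psi n))) (lam' n) (lam' m)).
  - by move=> t; have [_ ->] := aP (phi (psi n)).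
  - by move=> t; have [_ ->] := aP (phi (psi m)); rewrite -gE.
  - by rewrite a'1.
  - by rewrite a'1.
  - exact: lam_fin.
  - exact: lam_fin.
  - exact: lamc.
  - by rewrite ler_pdivrMr//; lra.
have [b [ab ab1]] := l1_complete ac.
have [b0 b1] := mass_limit a'0 a'1 ab ab1.
have sb : (l1 b < +oo)%E by rewrite b1 ltry.
(* The lower bound is uniform in [n], and the norm of the difference of masses bounds the difference
   of characteristic functions, so the bound survives in the limit. *)
have bmu t : expR (- (2 * C)) <= normc (ft b t).
  apply/ler_addgt0Pr => e e0; have [J /(_ J (leqnn J)) JP] := ab1 e e0.
  have := normc_spec (gamma (phi (psi J))) t (lC (phi (psi J))).
  have [_ <-] := aP (phi (psi J)); move/le_trans; apply.
  have -> : ft (a (phi (psi J))) t = ft b t + ft (fun x => a' J x - b x) t.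
    by rewrite (ftB t (is_mass_fin (Fm J)) sb) addrC subrK.
  by apply: le_trans (normcD _ _) _; rewrite lerD2l; exact: normc_ft.
have [G GD Gb] := cdf_of_D_S b0 b1 (expR_gt0 _) bmu.
by exists G => //; apply/(cvg_in_variationP Fm sb Gb).
Qed.

Lemma relatively_compact_iff :
  D_S_relatively_compact F <->
  [/\ finite_set (range gamma),
      (ereal_sup (range (fun n =>
         \esum_(v in zspan (growth_points (F n)) `\ 0%R) `|lambda n v|%:E))
       < +oo)%E &
      ereal_sup (range (fun n =>
         \esum_(v in (u @` [set k | K k /\ (N < k)%N]) `\ 0%R) `|lambda n v|%:E))
        @[N --> \oo] --> 0%E].
Proof.
have -> : (fun n => \esum_(v in zspan (growth_points (F n)) `\ 0%R) `|lambda n v|%:E)%E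
    = (fun n => l1 (lam n)) by apply/funext => n; exact: lam_esum.
have -> : (fun N => ereal_sup (range (fun n =>
    \esum_(v in (u @` [set k | K k /\ (N < k)%N]) `\ 0%R) `|lambda n v|%:E)%E)) =
    (fun N => ereal_sup (range (fun n => l1 (tail K u N (lam n))))).
  apply/funext => N; rewrite (_ : (fun n => _) = (fun n => l1 (tail K u N (lam n))))//.
  by apply/funext => n; exact: tail_esum.
split=> [RC|[gfin lsup tl]].
  by split; [exact: necessity_gamma|exact: necessity_bounded|exact: necessity_tail].
pose S := ereal_sup (range (fun n => l1 (lam n))).
have lS n : (l1 (lam n) <= S)%E by apply: ereal_sup_ubound; exists n.
have Sfin : S \is a fin_num.
  by rewrite ge0_fin_numE//; apply: le_trans (l1_ge0 _) (lS 0%N).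
by apply: (@sufficiency (fine S)) => // n; rewrite fineK.
Qed.

End Main.

Theorem theorem5 (R : realType) (F : nat -> distr_fun R)
  (gamma : nat -> R) (lambda : nat -> R -> R) (K : set nat) (u : nat -> R)
  (F_D_S : forall n, D_S (F n))
  (F_spectral : forall n, spectral_parameters (F n) (gamma n) (lambda n))
  (lambda_out : forall n v,
     ~ zspan (growth_points (F n)) v -> lambda n v = 0)
  (u_enum : enumerates K u (\bigcup_n zspan (growth_points (F n))))
  (u_0 : u 0%N = 0) :
  D_S_relatively_compact F <->
  [/\ finite_set (range gamma),
      (ereal_sup (range (fun n =>
         \esum_(v in zspan (growth_points (F n)) `\ 0%R) `|lambda n v|%:E))
       < +oo)%E &
      ereal_sup (range (fun n =>
         \esum_(v in (u @` [set k | K k /\ (N < k)%N]) `\ 0%R) `|lambda n v|%:E))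
        @[N --> \oo] --> 0%E].
Proof. exact: (relatively_compact_iff F_D_S F_spectral lambda_out u_enum). Qed.
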